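(* Let $\zeta=\zeta_{\varphi}$ be a Sturmian continued fraction with corresponding value $\sigma=\sigma_{\varphi}$ (as defined in the context). Then $$w_{3}(\zeta)=w_{3}^{\ast}(\zeta)=1+\frac{2}{\sigma},\qquad \lambda_{3}(\zeta)=\frac{1}{1+2\sigma},$$ and $$\widehat{w}_{3}(\zeta)=3,\qquad \widehat{\lambda}_{3}(\zeta)=\frac{1}{3},$$ and $$\widehat{w}_{3}^{\ast}(\zeta)=2+\sigma.$$
   Context: Sturmian continued fractions. Let $a,b$ be fixed distinct positive integers and $(s_{k})_{k\geq 1}$ a sequence of positive integers. Define finite words over $\{a,b\}$ by $m_{0}=b$, $m_{1}=b^{s_{1}-1}a$, and $m_{k+1}=m_{k}^{s_{k+1}}m_{k-1}$ for $k\geq 1$ (concatenation and powers of words). Put $\varphi=[0;s_{1},s_{2},s_{3},\ldots]$, let $m_{\varphi}=\lim_{k\to\infty}m_{k}=b^{s_{1}-1}a\cdots$ be the infinite limit word, and let $\zeta_{\varphi}=[0;m_{\varphi}]$ be the real number whose continued fraction expansion has integer part $0$ followed by the letters of $m_{\varphi}$ as partial quotients. Put $$\sigma_{\varphi}=\liminf_{k\to\infty}[0;s_{k},s_{k-1},\ldots,s_{1}]=\frac{1}{\limsup_{k\to\infty}[s_{k};s_{k-1},\ldots,s_{1}]}.$$ (One has $\sigma_\varphi\in[0,(\sqrt5-1)/2]$; if $\sigma_\varphi=0$, then $1+2/\sigma_\varphi$ is read as $\infty$.) Exponents. Let $\zeta$ be a real transcendental number and $n\ge 1$ an integer. $H(P)$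 denotes the maximum of the absolute values of the coefficients of a polynomial $P$. $w_{n}(\zeta)$ and $\widehat{w}_{n}(\zeta)$ are the suprema of $w\in\mathbb{R}$ such that $H(P)\leq X$, $0<|P(\zeta)|\leq X^{-w}$ has a solution $P\in\mathbb{Z}[T]$ of degree at most $n$ for arbitrarily large $X$, and for all large $X$, respectively. $\lambda_{n}(\zeta)$ and $\widehat{\lambda}_{n}(\zeta)$ are the suprema of $\lambda\in\mathbb{R}$ such that $1\leq |x|\leq X$, $\max_{1\leq i\leq n}|\zeta^{i}x-y_{i}|\leq X^{-\lambda}$ has a solution $(x,y_{1},\ldots,y_{n})\in\mathbb{Z}^{n+1}$ for arbitrarily large $X$, and for all large $X$, respectively. For an algebraic number $\alpha$, $H(\alpha)=H(P)$ where $P\in\mathbb{Z}[T]$ is its minimal polynomial with coprime coefficients. $w_{n}^{\ast}(\zeta)$ and $\widehat{w}_{n}^{\ast}(\zeta)$ are the suprema of $w^{\ast}\in\mathbb{R}$ such that $H(\alpha)\leq X$, $0<|\alpha-\zeta|\leq H(\alpha)^{-1}X^{-w^{\ast}}$ has a real algebraic solution $\alpha$ of degree at most $n$ for arbitrarily large $X$, and for all large $X$, respectively. *)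

(* Defs.v *)
From HB Require Import structures.
From mathcomp Require Import all_boot all_order all_algebra.
From mathcomp Require Import all_classical all_reals all_analysis.

Set Implicit Arguments.
Unset Strict Implicit.
Unset Printing Implicit Defensive.

Import Order.TTheory GRing.Theory Num.Theory.
Import numFieldNormedType.Exports.

Local Open Scope classical_set_scope.
Local Open Scope ring_scope.

(* Only the values s 1, s 2, ... are used; s 0 is irrelevant. *)
Fixpoint sturmian_word (a b : nat) (s : nat -> nat) (k : nat) : seq nat :=
  match k with
  | 0%N => [:: b]
  | k1.+1 =>
      match k1 with
      | 0%N => rcons (nseq (s 1%N).-1 b) a
      | k0.+1 => flatten (nseq (s k) (sturmian_word a b s k1))
                   ++ sturmian_word a b s k0
      end
  end.

(* The i-th letter (from 0) of the limit of the words m_k. Reading it off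
   m_(i+1) is legitimate: by [sturmian_limit_wordP], letter i of m_k exists
   and no longer depends on k as soon as k > i. *)
Definition sturmian_limit_word (a b : nat) (s : nat -> nat) (i : nat) : nat :=
  nth b (sturmian_word a b s i.+1) i.

Lemma sturmian_wordSS a b s k :
  sturmian_word a b s k.+2 =
  flatten (nseq (s k.+2) (sturmian_word a b s k.+1)) ++ sturmian_word a b s k.
Proof. by []. Qed.

Lemma sturmian_word_prefix a b s (hs : forall k, (0 < k)%N -> (0 < s k)%N) k :
  exists t, sturmian_word a b s k.+2 = sturmian_word a b s k.+1 ++ t.
Proof.
rewrite sturmian_wordSS.
have : (0 < s k.+2)%N by apply: hs.
case: (s k.+2) => // n _; rewrite [nseq _ _]/= [flatten (_ :: _)]/= -catA.
by eexists.
Qed.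

Lemma sturmian_word_size a b s (hs : forall k, (0 < k)%N -> (0 < s k)%N) k :
  (0 < size (sturmian_word a b s k))%N /\ (k < size (sturmian_word a b s k.+1))%N.
Proof.
elim: k => [|k [IH0 IH1]]; first by rewrite /= size_rcons.
split; first exact: leq_ltn_trans IH1.
rewrite sturmian_wordSS size_cat.
have : (0 < s k.+2)%N by apply: hs.
case: (s k.+2) => // n _; rewrite [nseq _ _]/= [flatten (_ :: _)]/= size_cat.
rewrite -[k.+2]addn1 leq_add //.
exact: leq_trans IH1 (leq_addr _ _).
Qed.

Lemma sturmian_limit_wordP a b s (hs : forall k, (0 < k)%N -> (0 < s k)%N) i k :
  (i < k)%N ->
  (i < size (sturmian_word a b s k))%N /\
  nth b (sturmian_word a b s k) i = sturmian_limit_word a b s i.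
Proof.
case: k => // k; rewrite ltnS => /subnKC <-.
elim: (k - i)%N => [|d [IH0 IH1]].
  by rewrite addn0; split => //; case: (sturmian_word_size a b hs i).
rewrite addnS; have [t ->] := sturmian_word_prefix a b hs (i + d).
by rewrite size_cat nth_cat IH0 IH1; split => //; apply: ltn_addr.
Qed.

Section real_definitions.
Variable R : realType.

(* [cfrac [:: c1; ...; cn]] is [0; c1, ..., cn]. *)
Definition cfrac (c : seq nat) : R := foldr (fun x y => (x%:R + y)^-1) 0 c.

Definition cfrac_lim (c : nat -> nat) : R := limn (fun n => cfrac (mkseq c n)).

Definition sturmian_cf (a b : nat) (s : nat -> nat) : R :=
  cfrac_lim (sturmian_limit_word a b s).

Definition sturmian_sigma (s : nat -> nat) : R :=
  limn_inf (fun k => cfrac (rev [seq s i | i <- iota 1 k])).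

Definition height (P : {poly int}) : nat := (\max_(i < size P) `|(P`_i)%R|)%N.

(* [zcontents P = 1] says that the coefficients of P are coprime and that its
   leading coefficient is positive. *)
Definition int_minpoly (alpha : R) (P : {poly int}) : Prop :=
  [/\ zcontents P = 1, root (map_poly intr P) alpha &
      forall Q : {poly int}, Q != 0 -> root (map_poly intr Q) alpha ->
        (size P <= size Q)%N].

Definition arbitrarily_large (S : R -> Prop) : Prop :=
  forall X0 : R, exists2 X : R, X0 <= X & S X.

Definition all_large (S : R -> Prop) : Prop :=
  exists X0 : R, forall X : R, X0 <= X -> S X.

Definition exponent_sup (S : R -> Prop) : \bar R :=
  ereal_sup [set w%:E | w in [set w : R | S w]].

Definition w_solvable (n : nat) (zeta w X : R) : Prop :=
  exists P : {poly int},
    [/\ (size P <= n.+1)%N, (height P)%:R <= X,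
        0 < `|(map_poly intr P).[zeta]| &
        `|(map_poly intr P).[zeta]| <= X `^ (- w)].

(* The entry y i, with i counted from 0, is the approximation of
   zeta^(i+1) * x. *)
Definition lambda_solvable (n : nat) (zeta lambda X : R) : Prop :=
  exists (x : int) (y : 'I_n -> int),
    1 <= `|x%:~R : R| <= X /\
    \big[Num.max/0]_(i < n) `|zeta ^+ i.+1 * x%:~R - (y i)%:~R|
      <= X `^ (- lambda).

Definition wstar_solvable (n : nat) (zeta w X : R) : Prop :=
  exists (alpha : R) (P : {poly int}),
    [/\ int_minpoly alpha P, (size P <= n.+1)%N, (height P)%:R <= X,
        0 < `|alpha - zeta| &
        `|alpha - zeta| <= (height P)%:R^-1 * X `^ (- w)].

Definition w_exp (n : nat) (zeta : R) : \bar R :=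
  exponent_sup (fun w => arbitrarily_large (w_solvable n zeta w)).

Definition w_hat (n : nat) (zeta : R) : \bar R :=
  exponent_sup (fun w => all_large (w_solvable n zeta w)).

Definition lambda_exp (n : nat) (zeta : R) : \bar R :=
  exponent_sup (fun l => arbitrarily_large (lambda_solvable n zeta l)).

Definition lambda_hat (n : nat) (zeta : R) : \bar R :=
  exponent_sup (fun l => all_large (lambda_solvable n zeta l)).

Definition wstar_exp (n : nat) (zeta : R) : \bar R :=
  exponent_sup (fun w => arbitrarily_large (wstar_solvable n zeta w)).

Definition wstar_hat (n : nat) (zeta : R) : \bar R :=
  exponent_sup (fun w => all_large (wstar_solvable n zeta w)).

Definition one_plus_two_over (sigma : R) : \bar R :=
  if sigma == 0 then +oo%E else (1 + 2 / sigma)%:E.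

End real_definitions.

(* Main.v *)
Require Import Defs.
From mathcomp Require Import all_boot all_order all_algebra.
From mathcomp Require Import all_classical all_reals all_analysis.
From mathcomp Require Import ring lra zify.

(** Write A_c for the matrix with rows (c, 1) and (1, 0), W_k for the product
of the A_c over the letters c of the word m_k, N_k for the upper left entry of
W_k, and P_k for the quadratic polynomial whose roots are the fixed points of
W_k acting on the directions (1, T).  Everything rests on four
facts.

(1) The coefficients of P_k have size about N_k.

(2) The value |P_k(zeta)| is about 1 / (N_k N_(k+1)^2).  Indeed the products
W_(k+1) W_k and W_k W_(k+1) have the form U A_a A_b and U A_b A_a in some order,
with the same U of determinant 1 or -1, so that the expansions of zeta and of
its image under W_k agree up to the point where these two products separate
[sturmian_mx_swap], [sturmian_value].

(3) For the same reason the commutator of W_(k+1) and W_k has determinant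
(a - b)^2 up to sign, and this is also the resultant of P_k and P_(k+1)
up to sign [sturmian_res].  It is thus bounded and nonzero: the four cubic polynomials
P_k, T P_k, P_(k+1), T P_(k+1) span, up to a bounded index, all integer
polynomials of degree at most 3.

(4) As zeta has bounded partial quotients, linear forms u zeta + v in integers
are never much smaller than the inverse of max(|u|, |v|), and get that small for
every prescribed size [badly_approximable], [linear_approximation].

These facts are collected in the record [quadratic_approximations], in terms of
L k = log N_k.  From it, the lower bounds for polynomials come from expanding the
determinant of P_k, T P_k, P and one of P_(k+1), T P_(k+1) for an integer cubic
P.  The determinant is an integer, and (T - zeta) P_k vanishes at zeta, so that
at most one row contributes its value at zeta to each term [det4_le].  Hence,
for P of height below N_(k+1), either |P(zeta)| is at least about
1 / (N_k^2 N_(k+1)), or P is a multiple of P_k by a linear factor, and then (4)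
applies [cubic_value_trichotomy], [multiple_value_ge].  Dually, a point
(y_0, ..., y_3) approximating the powers of zeta is paired with the same four
polynomials.  Two of these integers come from one and the same P_j and are
almost proportional in ratio 1 : zeta, so (4) bounds the error from below
[dual_nonorthogonal], [dual_dichotomy].

All these bounds are attained.  The polynomials P_k and their roots give the
exponents w and w*, the products of P_k with good linear forms give the uniform
exponent 3, and the functionals P |-> det(P_(k+1), T P_(k+1), P, B P_k), with B a
good linear form, give good simultaneous approximations [dual_points].  At the
parameter N_k the bounds for all polynomials, and for all points, balance: this is
why the two uniform exponents are 3 and 1/3.  At the parameters halfway between
two consecutive k the ratio L k / L (k+1) matters, and it is asymptotic to
[0; s_(k+1), ..., s_1] because log N_(k+1) is about s_(k+1) log N_k + log N_(k-1)
[sturmian_norm_step], [perturbed_close].  Its lower limit is sigma, which gives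
the other exponents [cubic_exponents]. *)

Set Implicit Arguments.
Unset Strict Implicit.
Unset Printing Implicit Defensive.

Import Order.TTheory GRing.Theory Num.Theory.
Import numFieldNormedType.Exports.

Local Open Scope ring_scope.

Local Notation toR R := (map_poly (intr : int -> R)).

(** * The determinant of two quadratic and two cubic polynomials *)

(** The determinant of the matrix whose rows are the coefficients of f, 'X * f,
p and q in degrees 0 to 3, for f of degree at most 2: the Laplace expansion
along the first two rows. *)
Definition det4 (R : comNzRingType) (f p q : {poly R}) : R :=
  f`_0 * f`_0 * (p`_2 * q`_3 - p`_3 * q`_2)
  - f`_0 * f`_1 * (p`_1 * q`_3 - p`_3 * q`_1)
  + f`_0 * f`_2 * (p`_1 * q`_2 - p`_2 * q`_1)
  + (f`_1 * f`_1 - f`_0 * f`_2) * (p`_0 * q`_3 - p`_3 * q`_0)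
  - f`_1 * f`_2 * (p`_0 * q`_2 - p`_2 * q`_0)
  + f`_2 * f`_2 * (p`_0 * q`_1 - p`_1 * q`_0).

(** The resultant of two quadratic polynomials, as a Sylvester determinant. *)
Definition res22 (R : comNzRingType) (f g : {poly R}) : R := det4 f g ('X * g).

Lemma coef_ge_size (R : nzSemiRingType) (p : {poly R}) m i :
  (size p <= m)%N -> (m <= i)%N -> p`_i = 0.
Proof. by move=> sp mi; rewrite nth_default // (leq_trans sp). Qed.

Lemma polyP4 (R : nzSemiRingType) (p q : {poly R}) :
  (size p <= 4)%N -> (size q <= 4)%N ->
  p`_0 = q`_0 -> p`_1 = q`_1 -> p`_2 = q`_2 -> p`_3 = q`_3 -> p = q.
Proof.
move=> sp sq e0 e1 e2 e3; apply/polyP=> -[|[|[|[|i]]]] //.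
by rewrite !(@coef_ge_size _ _ 4).
Qed.

Lemma size_linM (R : nzRingType) (u0 u1 : R) (f : {poly R}) :
  (size f <= 3)%N -> (size ((u0%:P + u1 *: 'X) * f)%R <= 4)%N.
Proof.
move=> sf; apply: (leq_trans (size_polyMleq _ _)).
have : (size (u0%:P + u1 *: 'X)%R <= 2)%N.
  rewrite addrC (leq_trans (size_polyD _ _)) // geq_max.
  by rewrite (leq_trans (size_scale_leq _ _)) ?size_polyX // (leq_trans (size_polyC_leq1 _)).
by move=> sA; rewrite -subn1 leq_subLR (leq_trans (leq_add sA sf)).
Qed.

Lemma coef_linM (R : comNzRingType) (u0 u1 : R) (f : {poly R}) i :
  ((u0%:P + u1 *: 'X) * f)`_i = u0 * f`_i + u1 * (if i is j.+1 then f`_j else 0).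
Proof.
by rewrite mulrDl mul_polyC -scalerAl coefD !coefZ coefXM; case: i.
Qed.

(** Cramer's rule in the basis f, 'X * f, g, 'X * g.  When [res22 f g] is bounded
it shows that every integer cubic is a combination of these four polynomials
with bounded denominators. *)
Lemma cramer4 (R : comNzRingType) (f g p : {poly R}) :
  (size f <= 3)%N -> (size g <= 3)%N -> (size p <= 4)%N ->
  res22 f g *: p =
  ((det4 g p ('X * f))%:P + det4 g f p *: 'X) * f
  + ((det4 f p ('X * g))%:P + det4 f g p *: 'X) * g.
Proof.
move=> sf sg sp.
have f3 := coef_ge_size sf (leqnn 3); have g3 := coef_ge_size sg (leqnn 3).
apply: polyP4.
- by rewrite (leq_trans (size_scale_leq _ _)).
- by rewrite (leq_trans (size_polyD _ _)) // geq_max !size_linM.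
all: by rewrite coefZ coefD !coef_linM /res22 /det4 !coefXM /= ?f3 ?g3; ring.
Qed.

Lemma horner4 (R : comNzRingType) (p : {poly R}) z : (size p <= 4)%N ->
  p.[z] = p`_0 + p`_1 * z + p`_2 * z ^+ 2 + p`_3 * z ^+ 3.
Proof.
move=> sp; rewrite (horner_coef_wide _ sp) !big_ord_recr big_ord0 /=.
by rewrite expr0 expr1; ring.
Qed.

Lemma horner3 (R : comNzRingType) (p : {poly R}) z : (size p <= 3)%N ->
  p.[z] = p`_0 + p`_1 * z + p`_2 * z ^+ 2.
Proof.
move=> sp; rewrite (horner_coef_wide _ sp) !big_ord_recr big_ord0 /=.
by rewrite expr0 expr1; ring.
Qed.

Lemma ler_normM (R : numDomainType) (x y a b : R) :
  `|x| <= a -> `|y| <= b -> `|x * y| <= a * b.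
Proof. by move=> xa yb; rewrite normrM ler_pM. Qed.

Lemma ler_normDD (R : numDomainType) (x y a b : R) :
  `|x| <= a -> `|y| <= b -> `|x + y| <= a + b.
Proof. by move=> xa yb; rewrite (le_trans (ler_normD _ _)) // lerD. Qed.

Lemma ler_normBD (R : numDomainType) (x y a b : R) :
  `|x| <= a -> `|y| <= b -> `|x - y| <= a + b.
Proof. by move=> xa yb; rewrite (le_trans (ler_normB _ _)) // lerD. Qed.

(** The determinant does not change when coefficients are taken in powers of
'X - z, and when 'X * f is replaced by ('X - z) * f, which vanishes at z.  In
these coordinates the column of values is (f(z), 0, p(z), q(z)); each term of the
expansion contains one entry of it, and all other entries are bounded by a
constant times the heights. *)
Lemma det4_le (R : realFieldType) (f p q : {poly R}) (z F H G : R) :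
  (size f <= 3)%N -> (size p <= 4)%N -> (size q <= 4)%N ->
  0 <= z <= 1 ->
  (forall i, `|f`_i| <= F) -> (forall i, `|p`_i| <= H) ->
  (forall i, `|q`_i| <= G) ->
  `|det4 f p q| <= 108 * (`|f.[z]| * F * H * G
                          + F * F * (`|p.[z]| * G + H * `|q.[z]|)).
Proof.
move=> sf sp sq /andP[z0 z1] hf hp hq.
have F0 : 0 <= F by exact: le_trans (hf 0).
have H0 : 0 <= H by exact: le_trans (hp 0).
have G0 : 0 <= G by exact: le_trans (hq 0).
have nz : `|z| <= 1 by rewrite ger0_norm.
have nz2 : `|z ^+ 2| <= 1 by rewrite normrX ger0_norm // exprn_ile1.
set vf := f.[z]; set vp := p.[z]; set vq := q.[z].
pose f1 := f`_1 + f`_2 * z * 2.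
pose p1 := p`_1 + p`_2 * z * 2 + p`_3 * z ^+ 2 * 3.
pose q1 := q`_1 + q`_2 * z * 2 + q`_3 * z ^+ 2 * 3.
pose p2 := p`_2 + p`_3 * z * 3; pose q2 := q`_2 + q`_3 * z * 3.
have -> : det4 f p q = vf * vf * (p2 * q`_3 - p`_3 * q2)
  - vf * f1 * (p1 * q`_3 - p`_3 * q1) + vf * f`_2 * (p1 * q2 - p2 * q1)
  + (f1 * f1 - vf * f`_2) * (vp * q`_3 - p`_3 * vq)
  - f1 * f`_2 * (vp * q2 - p2 * vq) + f`_2 * f`_2 * (vp * q1 - p1 * vq).
  rewrite /vf /vp /vq horner3 // !horner4 // /det4 /f1 /p1 /p2 /q1 /q2; ring.
have bf1 : `|f1| <= 3 * F.
  have := ler_normDD (hf 1) (ler_normM (ler_normM (hf 2) nz) (_ : `|2| <= 2)).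
  by rewrite normr_nat => /(_ (lexx _)); rewrite -/f1; lra.
have bvf : `|vf| <= 3 * F.
  have := ler_normDD (ler_normDD (hf 0) (ler_normM (hf 1) nz)) (ler_normM (hf 2) nz2).
  by rewrite /vf horner3 //; lra.
have b2 (r : {poly R}) K : (forall i, `|r`_i| <= K) -> `|r`_2 + r`_3 * z * 3| <= 4 * K.
  move=> hr; have := ler_normDD (hr 2) (ler_normM (ler_normM (hr 3) nz) (_ : `|3| <= 3)).
  by rewrite normr_nat => /(_ (lexx _)); lra.
have b1 (r : {poly R}) K : (forall i, `|r`_i| <= K) ->
    `|r`_1 + r`_2 * z * 2 + r`_3 * z ^+ 2 * 3| <= 6 * K.
  move=> hr; have := ler_normDD (ler_normDD (hr 1) (ler_normM (ler_normM (hr 2) nz) (_ : `|2| <= 2)))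
    (ler_normM (ler_normM (hr 3) nz2) (_ : `|3| <= 3)).
  by rewrite !normr_nat => /(_ (lexx _) (lexx _)); lra.
have bp1 : `|p1| <= 6 * H by exact: b1.
have bq1 : `|q1| <= 6 * G by exact: b1.
have bp2 : `|p2| <= 4 * H by exact: b2.
have bq2 : `|q2| <= 4 * G by exact: b2.
(* The minors of the two pairs of rows that occur in the expansion. *)
have minor (u v u' v' U V U' V' : R) : `|u| <= U -> `|v| <= V -> `|u'| <= U' ->
    `|v'| <= V' -> `|u * v - u' * v'| <= U * V + U' * V'.
  by move=> ? ? ? ?; apply: ler_normBD; apply: ler_normM.
have m23 := minor _ _ _ _ _ _ _ _ bp2 (hq 3) (hp 3) bq2.
have m13 := minor _ _ _ _ _ _ _ _ bp1 (hq 3) (hp 3) bq1.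
have m12 := minor _ _ _ _ _ _ _ _ bp1 bq2 bp2 bq1.
have m03 := minor _ _ _ _ _ _ _ _ (lexx `|vp|) (hq 3) (hp 3) (lexx `|vq|).
have m02 := minor _ _ _ _ _ _ _ _ (lexx `|vp|) bq2 bp2 (lexx `|vq|).
have m01 := minor _ _ _ _ _ _ _ _ (lexx `|vp|) bq1 bp1 (lexx `|vq|).
have n12 := minor _ _ _ _ _ _ _ _ bf1 bf1 bvf (hf 2).
have lf := lexx `|vf|.
have E := ler_normDD (ler_normBD (ler_normDD (ler_normDD (ler_normBD
  (ler_normM (ler_normM lf bvf) m23) (ler_normM (ler_normM lf bf1) m13))
  (ler_normM (ler_normM lf (hf 2)) m12)) (ler_normM n12 m03))
  (ler_normM (ler_normM bf1 (hf 2)) m02)) (ler_normM (ler_normM (hf 2) (hf 2)) m01).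
apply: le_trans E _.
rewrite -subr_ge0.
have P1 : 0 <= F * F * `|vp| * G by rewrite !mulr_ge0.
have P2 : 0 <= F * F * H * `|vq| by rewrite !mulr_ge0.
rewrite [leRHS](_ : _ = 78 * (F * F * `|vp| * G) + 78 * (F * F * H * `|vq|)); last by ring.
by lra.
Qed.

Lemma det4_map (f p q : {poly int}) (R : realFieldType) :
  det4 (map_poly intr f) (map_poly intr p) (map_poly intr q) = (det4 f p q)%:~R :> R.
Proof. by rewrite /det4 !coef_map /=; ring. Qed.

(** * Approximation by a sequence of quadratic polynomials *)

(** What the proof uses about zeta: a sequence of integer quadratic polynomials
f k of height about exp (L k), small at z at the best possible rate, with
consecutive ones coprime in the strong sense that their resultant is bounded,
together with the fact that z is badly approximable.  All constants are absorbed
in the single factor exp kap.  The last field says that f k has a root close to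
z that is not rational. *)
Record quadratic_approximations (R : realType) (z kap : R) (L : nat -> R)
    (f : nat -> {poly int}) : Prop := QuadraticApproximations {
  qa_kap : 0 <= kap;
  qa_z : 0 <= z <= 1;
  qa_L0 : 0 <= L 0;
  qa_mono : forall k, L k <= L k.+1;
  qa_unbounded : forall x, exists k, x <= L k;
  qa_size : forall k, (size (f k) <= 3)%N;
  qa_coef : forall k i, `|((f k)`_i)%:~R : R| <= expR (kap + L k);
  qa_const : forall k, expR (L k - kap) <= `|((f k)`_0)%:~R : R|;
  qa_lead : forall k, expR (L k - kap) <= `|((f k)`_2)%:~R : R|;
  qa_val_le : forall k,
    `|(toR R (f k)).[z]| <= expR (kap - L k - 2 * L k.+1);
  qa_val_ge : forall k,
    expR (- kap - L k - 2 * L k.+1) <= `|(toR R (f k)).[z]|;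
  qa_res_neq0 : forall k, res22 (f k) (f k.+1) != 0;
  qa_res_le : forall k, `|(res22 (f k) (f k.+1))%:~R : R| <= expR kap;
  qa_bad : forall (u v : int) (x : R), (u != 0) || (v != 0) ->
    `|u%:~R : R| <= expR x -> `|v%:~R : R| <= expR x ->
    expR (- kap - x) <= `|u%:~R * z + v%:~R|;
  qa_good : forall x : R, 0 <= x -> exists u v : int,
    [/\ (u != 0) || (v != 0), `|u%:~R : R| <= expR x,
        `|v%:~R : R| <= expR x & `|u%:~R * z + v%:~R| <= expR (kap - x)];
  qa_root : forall k, exists alpha : R,
    [/\ root (toR R (f k)) alpha,
        `|alpha - z| <= expR (kap - 2 * L k - 2 * L k.+1) &
        forall Q : {poly int}, Q != 0 -> root (toR R Q) alpha ->
          (2 < size Q)%N]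
}.

Section helpers.
Variable R : realType.
Implicit Types x y : R.

Lemma intr_norm_ge1 (n : int) : n != 0 -> 1 <= `|n%:~R : R|.
Proof. by move=> n0; rewrite -intr_norm ler1z -gtz0_ge1 normr_gt0. Qed.

(** Turns numerical constants into exponentials, so that the estimates become
linear inequalities between exponents. *)
Lemma ler_nat_expR n : n%:R <= expR n%:R :> R.
Proof. by have := expR_ge1Dx (n%:R : R); lra. Qed.

Lemma expR_norm_gt0 x y : expR x <= `|y| -> y != 0.
Proof. by move=> xy; rewrite -normr_gt0 (lt_le_trans _ xy) ?expR_gt0. Qed.

Lemma size_toR (P : {poly int}) : size (toR R P) = size P.
Proof. by apply: size_map_inj_poly; [exact: intr_inj|]. Qed.

Lemma horner_mulX_le (P : {poly R}) z : 0 <= z <= 1 ->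
  `|('X * P).[z]| <= `|P.[z]|.
Proof.
by move=> /andP[z0 z1]; rewrite hornerM hornerX normrM ger0_norm // ler_piMl.
Qed.

Lemma toRM (P Q : {poly int}) : toR R (P * Q) = toR R P * toR R Q.
Proof. by rewrite rmorphM. Qed.

Lemma toR_lin (u v : int) : toR R (u%:P + v *: 'X) = (u%:~R)%:P + v%:~R *: 'X.
Proof. by rewrite rmorphD /= map_polyC map_polyZ /= map_polyX. Qed.

Lemma horner_lin (u v z : R) : (u%:P + v *: 'X).[z] = v * z + u.
Proof. by rewrite hornerD hornerZ hornerX hornerC addrC. Qed.

End helpers.

Section metric.
Variables (R : realType) (z kap : R) (L : nat -> R) (f : nat -> {poly int}).
Hypothesis qa : quadratic_approximations z kap L f.

Let kap0 := qa_kap qa.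

Lemma scale_mono m n : (m <= n)%N -> L m <= L n.
Proof. by move=> mn; apply: (homo_leq (r := <=%R) lexx le_trans (qa_mono qa)). Qed.

Lemma scale_ge0 k : 0 <= L k.
Proof. by apply: le_trans (scale_mono (leq0n k)); exact: (qa_L0 qa). Qed.

Lemma scale_eventually_ge x : exists k0, forall k, (k0 <= k)%N -> x <= L k.
Proof.
by have [k0 xk0] := qa_unbounded qa x; exists k0 => k /scale_mono; exact: le_trans.
Qed.

(** Selects the index adapted to a given height. *)
Lemma scale_bracket k0 x : L k0 <= x ->
  exists2 k, (k0 <= k)%N & L k <= x < L k.+1.
Proof.
move=> k0x; have [n0 xn0] := qa_unbounded qa (x + 1).
have ex : exists n, x < L n by exists n0; lra.
have [n xn minn] := ex_minnP ex.
case: n xn minn => [|n] xn minn.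
  by have := scale_mono (leq0n k0); lra.
exists n.
  by rewrite leqNgt; apply/negP => nk0; have := scale_mono nk0; lra.
by rewrite xn andbT leNgt; apply/negP => /minn; rewrite ltnn.
Qed.

Lemma int_det4_ge1 (p q r : {poly int}) : det4 p q r != 0 ->
  1 <= `|det4 (toR R p) (toR R q) (toR R r)|.
Proof. by rewrite det4_map; exact: intr_norm_ge1. Qed.

(** If one of the determinants of f k, 'X * f k, P with f (k+1) or with
'X * f (k+1) is nonzero, it is at least 1 in absolute value, and the bound
[det4_le] gives one of the first two cases.  If both vanish, Cramer's rule shows
that P is a multiple of f k, with denominator the resultant. *)
Lemma cubic_value_trichotomy : exists2 K, 0 <= K &
  forall k (P : {poly int}) x, (size P <= 4)%N ->
    (forall i, `|(P`_i)%:~R : R| <= expR x) ->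
  [\/ L k.+1 <= K + x,
      expR (- K - 2 * L k - L k.+1) <= `|(toR R P).[z]| |
      exists u0 u1 : int,
        res22 (f k) (f k.+1) *: P = (u0%:P + u1 *: 'X) * f k].
Proof.
have [kap0' z01] := (kap0, qa_z qa).
(* 432 = 4 * 108, where 108 is the constant of [det4_le]: each of the two terms
   without P(z) is then at most a quarter. *)
exists (3 * kap + 432); first by lra.
move=> k P x sP hP.
have det_case (Q : {poly int}) : (size Q <= 4)%N ->
    (forall i, `|(Q`_i)%:~R : R| <= expR (kap + L k.+1)) ->
    `|(toR R Q).[z]| <= expR (kap - L k.+1 - 2 * L k.+2) ->
    det4 (f k) P Q != 0 -> L k.+1 <= 3 * kap + 432 + x \/
    expR (- (3 * kap + 432) - 2 * L k - L k.+1) <= `|(toR R P).[z]|.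
  move=> sQ hQ vQ /int_det4_ge1 D1.
  case: (lerP (L k.+1) (3 * kap + 432 + x)) => Lx; [by left|right].
  have cf (S : {poly int}) B : (forall i, `|(S`_i)%:~R : R| <= B) ->
      forall i, `|(toR R S)`_i| <= B by move=> h i; rewrite coef_map; exact: h.
  have [sf' sP' sQ'] : [/\ (size (toR R (f k)) <= 3)%N, (size (toR R P) <= 4)%N
      & (size (toR R Q) <= 4)%N] by rewrite !size_toR; split=> //; exact: (qa_size qa).
  have D2 := det4_le sf' sP' sQ' z01 (cf _ _ (qa_coef qa k)) (cf _ _ hP) (cf _ _ hQ).
  set v := `|(toR R P).[z]| in D2 *.
  have v0 : 0 <= v by exact: normr_ge0.
  have t1 : `|(toR R (f k)).[z]| * expR (kap + L k) * expR x * expR (kap + L k.+1)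
      <= expR (3 * kap + x - L k.+1).
    rewrite -!mulrA -!expRD.
    apply: le_trans (ler_wpM2r (expR_ge0 _) (qa_val_le qa k)) _.
    by rewrite -expRD ler_expR; lra.
  have t2 : expR (kap + L k) * expR (kap + L k) * (v * expR (kap + L k.+1)) =
     v * expR (3 * kap + 2 * L k + L k.+1).
    rewrite mulrCA -!expRD; congr (_ * expR _); lra.
  have t3 : expR (kap + L k) * expR (kap + L k) * (expR x * `|(toR R Q).[z]|)
     <= expR (3 * kap + x - L k.+1).
    rewrite mulrA -!expRD.
    apply: le_trans (ler_wpM2l (expR_ge0 _) vQ) _.
    rewrite -expRD ler_expR.
    by have := scale_mono (leq_trans (leqnSn k) (leqnSn k.+1)); lra.
  have t4 : 432 * expR (3 * kap + x - L k.+1) <= 1.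
    have h : (432 : R) <= expR 432 := ler_nat_expR R 432.
    apply: le_trans (ler_wpM2r (expR_ge0 _) h) _.
    by rewrite -expRD -[leRHS]expR0 ler_expR; lra.
  have t5 : 1 <= 432 * (v * expR (3 * kap + 2 * L k + L k.+1)).
    move: D2; rewrite [expR _ * expR _ * (_ + _)]mulrDr t2; lra.
  have t6 : 1 <= v * expR (3 * kap + 432 + 2 * L k + L k.+1).
    apply: le_trans t5 _.
    rewrite (_ : 3 * kap + 432 + 2 * L k + L k.+1 = 432 + (3 * kap + 2 * L k + L k.+1)); last by ring.
    rewrite [expR (432 + _)]expRD [leRHS]mulrCA.
    by apply: ler_wpM2r; [exact: mulr_ge0 v0 (expR_ge0 _)|exact: (ler_nat_expR R 432)].
  rewrite -(ler_pM2r (expR_gt0 (3 * kap + 432 + 2 * L k + L k.+1))).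
  apply: le_trans t6; rewrite -expRD -[leRHS]expR0 ler_expR; lra.
have sg := qa_size qa k.+1.
have sXg : (size ('X * f k.+1)%R <= 4)%N.
  by rewrite (leq_trans (size_polyMleq _ _)) // size_polyX.
have sg4 : (size (f k.+1) <= 4)%N by exact: leq_trans sg _.
have cX i : `|(('X * f k.+1)`_i)%:~R : R| <= expR (kap + L k.+1).
  by rewrite coefXM; case: i => [|i] /=; [rewrite normr0 expR_ge0|exact: (qa_coef qa)].
have vX : `|(toR R ('X * f k.+1)).[z]| <= expR (kap - L k.+1 - 2 * L k.+2).
  rewrite toRM map_polyX; apply: le_trans (horner_mulX_le _ z01) _.
  exact: (qa_val_le qa).
have [e1|/(det_case _ sXg cX vX)[]] := eqVneq (det4 (f k) P ('X * f k.+1)) 0; last 2 first.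
- by move=> ?; apply: Or31.
- by move=> ?; apply: Or32.
have [e2|/(det_case _ sg4 (qa_coef qa k.+1) (qa_val_le qa k.+1))[]] :=
  eqVneq (det4 (f k) P (f k.+1)) 0; last 2 first.
- by move=> ?; apply: Or31.
- by move=> ?; apply: Or32.
apply: Or33; exists (det4 (f k.+1) P ('X * f k)), (det4 (f k.+1) (f k) P).
rewrite (cramer4 (qa_size qa k) sg sP) e1 [det4 (f k) (f k.+1) P](_ : _ = 0).
  by rewrite scale0r addr0 mul0r addr0.
by rewrite -[RHS]oppr0 -e2 /det4; ring.
Qed.

(** The coefficients of the linear factor are read off from the extreme
coefficients of the product, so they are bounded by the height of P over that of
f k; then bad approximability bounds the value of the linear factor at z. *)
Lemma multiple_value_ge : exists2 K, 0 <= K &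
  forall k (P : {poly int}) x (u0 u1 : int), P != 0 ->
    (forall i, `|(P`_i)%:~R : R| <= expR x) ->
    res22 (f k) (f k.+1) *: P = (u0%:P + u1 *: 'X) * f k ->
  expR (- K - 2 * L k.+1 - x) <= `|(toR R P).[z]|.
Proof.
exists (5 * kap); first by have := kap0; lra.
move=> k P x u0 u1 P0 hP E.
have D0 := qa_res_neq0 qa k; have DK := qa_res_le qa k.
set D := res22 _ _ in E D0 DK.
have bound (u a c : int) : D * c = u * a -> expR (L k - kap) <= `|a%:~R : R| ->
    `|c%:~R : R| <= expR x -> `|u%:~R : R| <= expR (2 * kap + x - L k).
  move=> e ha hc.
  have : `|u%:~R * a%:~R : R| <= expR kap * expR x.
    by rewrite -intrM -e intrM; apply: ler_normM.
  rewrite normrM => h.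
  have h2 : `|u%:~R : R| * expR (L k - kap) <= expR kap * expR x.
    by apply: le_trans h; apply: ler_wpM2l.
  rewrite -(ler_pM2r (expR_gt0 (L k - kap))) (le_trans h2) // -!expRD ler_expR; lra.
have f3 := coef_ge_size (qa_size qa k) (leqnn 3).
have h0 : `|u0%:~R : R| <= expR (2 * kap + x - L k).
  apply: (bound _ _ (P`_0) _ (qa_const qa k) (hP 0)).
  by rewrite -coefZ E coef_linM mulr0 addr0.
have h1 : `|u1%:~R : R| <= expR (2 * kap + x - L k).
  apply: (bound _ _ (P`_3) _ (qa_lead qa k) (hP 3)).
  by rewrite -coefZ E coef_linM /= f3 mulr0 add0r.
have u0n : (u1 != 0) || (u0 != 0).
  apply/negPn; rewrite negb_or !negbK; apply/negP=> /andP[/eqP e1 /eqP e0].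
  have : D *: P == 0 by rewrite E e0 e1 scale0r addr0 polyC0 mul0r.
  by rewrite -size_poly_eq0 size_scale // size_poly_eq0 (negPf P0).
have B := qa_bad qa u0n h1 h0.
have V := qa_val_ge qa k.
have EV : D%:~R * (toR R P).[z] = (u1%:~R * z + u0%:~R) * (toR R (f k)).[z].
  rewrite -horner_lin -toR_lin -hornerM -toRM -E map_polyZ hornerZ //.
have : expR (- kap - (2 * kap + x - L k)) * expR (- kap - L k - 2 * L k.+1)
   <= `|D%:~R * (toR R P).[z]|.
  by rewrite EV normrM ler_pM ?expR_ge0.
rewrite normrM -expRD => h.
have h2 := le_trans h (ler_wpM2r (normr_ge0 _) DK).
rewrite -(ler_pM2l (expR_gt0 kap)) (le_trans _ h2) // -expRD ler_expR; lra.
Qed.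

(** Multiplying f k by a good linear form trades height for value: the product of
the two stays constant as t grows. *)
Lemma linear_multiple k t : 0 <= t -> exists u v : int,
  let Q := (v%:P + u *: 'X) * f k in
  [/\ (u != 0) || (v != 0), (size Q <= 4)%N,
      forall i, `|(Q`_i)%:~R : R| <= 2 * expR (kap + L k + t),
      0 < `|(toR R Q).[z]| &
      `|(toR R Q).[z]| <= expR (2 * kap - t - L k - 2 * L k.+1)].
Proof.
move=> t0; have [u [v [uv0 ut vt uvt]]] := qa_good qa t0.
exists u, v => Q; have VQ : (toR R Q).[z] = (u%:~R * z + v%:~R) * (toR R (f k)).[z].
  by rewrite toRM toR_lin hornerM horner_lin.
split=> //.
- by apply: size_linM; exact: (qa_size qa).
- move=> i.
  have B j : `|((f k)`_j)%:~R : R| <= expR (kap + L k) by exact: (qa_coef qa).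
  have B' : `|(if i is j.+1 then (f k)`_j else 0)%:~R : R| <= expR (kap + L k).
    by case: i => [|i] //; rewrite normr0 expR_ge0.
  rewrite coef_linM rmorphD !rmorphM /=.
  have := ler_normDD (ler_normM vt (B i)) (ler_normM ut B').
  rewrite -expRD (_ : t + (kap + L k) = kap + L k + t); [lra|ring].
- rewrite VQ normrM mulr_gt0 //.
    exact: lt_le_trans (expR_gt0 _) (qa_bad qa uv0 ut vt).
  exact: lt_le_trans (expR_gt0 _) (qa_val_ge qa k).
- rewrite VQ; apply: le_trans (ler_normM uvt (qa_val_le qa k)) _.
  by rewrite -expRD ler_expR; lra.
Qed.

Lemma cubic_value_ge : exists2 K, 0 <= K &
  forall k (P : {poly int}) x, P != 0 -> (size P <= 4)%N ->
    (forall i, `|(P`_i)%:~R : R| <= expR x) -> K + x < L k.+1 ->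
  expR (- K - 2 * L k - L k.+1) <= `|(toR R P).[z]| \/
  expR (- K - 2 * L k.+1 - x) <= `|(toR R P).[z]|.
Proof.
have [K1 K10 tri] := cubic_value_trichotomy.
have [K2 K20 mul] := multiple_value_ge.
exists (K1 + K2); first exact: addr_ge0.
move=> k P x P0 sP hP Lx; case: (tri k P x sP hP) => [|h|[u0 [u1 E]]].
- by lra.
- by left; apply: le_trans h; rewrite ler_expR; lra.
- by right; apply: le_trans (mul k P x u0 u1 P0 hP E); rewrite ler_expR; lra.
Qed.

End metric.

(** * Simultaneous approximation *)

Definition pair4 (y : nat -> int) (p : {poly int}) : int :=
  p`_0 * y 0 + p`_1 * y 1 + p`_2 * y 2 + p`_3 * y 3.

Lemma pair4_lin y (u0 u1 : int) (p : {poly int}) :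
  pair4 y ((u0%:P + u1 *: 'X) * p) = u0 * pair4 y p + u1 * pair4 y ('X * p).
Proof. by rewrite /pair4 !coef_linM !coefXM /=; ring. Qed.

Lemma pair4D y p q : pair4 y (p + q) = pair4 y p + pair4 y q.
Proof. by rewrite /pair4 !coefD; ring. Qed.

Lemma pair4Z y c p : pair4 y (c *: p) = c * pair4 y p.
Proof. by rewrite /pair4 !coefZ; ring. Qed.

(** By Cramer's rule the monomials are rational combinations of f, 'X * f, g and
'X * g, so a vector orthogonal to these four polynomials is zero. *)
Lemma pair4_eq0 y (f g : {poly int}) :
  (size f <= 3)%N -> (size g <= 3)%N -> res22 f g != 0 ->
  pair4 y f = 0 -> pair4 y ('X * f) = 0 ->
  pair4 y g = 0 -> pair4 y ('X * g) = 0 ->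
  forall i, (i < 4)%N -> y i = 0.
Proof.
move=> sf sg r0 f0 f1 g0 g1 i i4.
have : pair4 y (res22 f g *: 'X^i) = 0.
  rewrite cramer4 ?size_polyXn // pair4D !pair4_lin f0 f1 g0 g1; ring.
rewrite pair4Z => /eqP; rewrite mulf_eq0 (negPf r0) /= => /eqP.
by case: i i4 => [|[|[|[|]]]] // _; rewrite /pair4 !coefXn /= => <-; ring.
Qed.

Section dual.
Variables (R : realType) (z kap : R) (L : nat -> R) (f : nat -> {poly int}).
Hypothesis qa : quadratic_approximations z kap L f.

Let kap0 := qa_kap qa.

(** Let n0 and n1 be the pairings of y with f k and 'X * f k.  Then n0 is y 0
times f k (z) up to an error, while z * n0 - n1 consists of errors only, since
('X - z) * f k vanishes at z.  Bad approximability applied to the integers n0, n1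
bounds the product of the two sizes from below; the first alternative is the
case where the error dominates n0. *)
Lemma dual_nonorthogonal k (y : nat -> int) x l :
  `|(y 0)%:~R : R| <= expR x ->
  (forall i, (i < 4)%N -> `|z ^+ i * (y 0)%:~R - (y i)%:~R| <= expR (- l)) ->
  (pair4 y (f k) != 0) || (pair4 y ('X * f k) != 0) ->
  l <= 3 * kap + 11 + L k \/ 2 * L k.+1 <= 3 * kap + 11 + x - l.
Proof.
move=> y0x yl nz; have z01 := qa_z qa; have /andP[z0 z1] := z01.
pose n0 : R := (pair4 y (f k))%:~R; pose n1 : R := (pair4 y ('X * f k))%:~R.
have f3 := coef_ge_size (qa_size qa k) (leqnn 3).
have C := qa_coef qa k; have V := qa_val_le qa k.
set E := expR (kap + L k - l).
have CE i j : (j < 4)%N ->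
    `|((f k)`_i)%:~R * (z ^+ j * (y 0)%:~R - (y j)%:~R)| <= E.
  by move=> j4; rewrite /E expRD; apply: ler_normM; [exact: C|exact: yl].
have vf : (toR R (f k)).[z] =
    ((f k)`_0)%:~R + ((f k)`_1)%:~R * z + ((f k)`_2)%:~R * z ^+ 2.
  by rewrite horner3 ?size_toR ?(qa_size qa) // !coef_map.
pose S1 := ((f k)`_1)%:~R * (z ^+ 1 * (y 0)%:~R - (y 1)%:~R)
  + ((f k)`_2)%:~R * (z ^+ 2 * (y 0)%:~R - (y 2)%:~R).
pose S2 := ((f k)`_0)%:~R * (z ^+ 1 * (y 0)%:~R - (y 1)%:~R)
  + ((f k)`_1)%:~R * (z ^+ 2 * (y 0)%:~R - (y 2)%:~R)
  + ((f k)`_2)%:~R * (z ^+ 3 * (y 0)%:~R - (y 3)%:~R).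
have n0E : n0 = (y 0)%:~R * (toR R (f k)).[z] - S1.
  by rewrite vf /S1 /n0 /pair4 f3; ring.
have n1E : n1 = z * n0 + (z * S1 - S2).
  by rewrite n0E vf /n1 /pair4 !coefXM /S1 /S2 /=; ring.
have E0 : 0 <= E by exact: expR_ge0.
have nz1 : `|z| <= 1 by rewrite ger0_norm.
have S1E : `|S1| <= 2 * E.
  by have := ler_normDD (CE 1 1 isT) (CE 2 2 isT); rewrite -/S1; lra.
have S2E : `|S2| <= 3 * E.
  by have := ler_normDD (ler_normDD (CE 0 1 isT) (CE 1 2 isT)) (CE 2 3 isT); rewrite -/S2; lra.
have dE : `|n0 * z + - n1| <= 5 * E.
  have -> : n0 * z + - n1 = S2 - z * S1 by rewrite n1E; ring.
  by have := ler_normBD S2E (ler_normM nz1 S1E); lra.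
(* M1 and M2 are the exponents of the main term of n0 and of the errors. *)
set M1 := x + kap - L k - 2 * L k.+1; set M2 := kap + L k - l + 9.
have n0B : `|n0| <= expR M1 + 2 * E.
  rewrite n0E (_ : M1 = x + (kap - L k - 2 * L k.+1)); last by rewrite /M1; ring.
  by rewrite expRD; exact: ler_normBD (ler_normM y0x V) S1E.
have n1B : `|- n1| <= expR M1 + 7 * E.
  have -> : - n1 = (n0 * z + - n1) - n0 * z by ring.
  by have := ler_normBD dE (ler_normM n0B nz1); lra.
have EM2 : 9 * E <= expR M2.
  rewrite /M2 [expR (_ + 9)]expRD mulrC; apply: ler_wpM2l => //.
  exact: (ler_nat_expR R 9).
have three : (3 : R) <= expR 2 by have := expR_ge1Dx (2 : R); lra.
have bad M : expR M1 <= expR M -> expR M2 <= expR M -> - kap - (M + 2) <= M2.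
  move=> h1 h2.
  have h3 : expR M1 + 9 * E <= expR (M + 2).
    rewrite expRD; have := ler_wpM2l (expR_ge0 M) three.
    by have := expR_ge0 M; clear - h1 h2 EM2; lra.
  have nz' : (pair4 y (f k) != 0) || (- pair4 y ('X * f k) != 0) by rewrite oppr_eq0.
  have h4 : `|n0| <= expR (M + 2) -> `|- n1| <= expR (M + 2) ->
      expR (- kap - (M + 2)) <= `|n0 * z + - n1|.
    by move: (qa_bad qa (x := M + 2) nz'); rewrite mulrNz.
  rewrite -ler_expR; apply: le_trans (h4 _ _) (le_trans dE _).
  - by clear - n0B h3 E0; lra.
  - by clear - n1B h3 E0; lra.
  - by clear - EM2 E0; lra.
have [M12|M21] := lerP M1 M2.
  by left; have := bad M2; rewrite !ler_expR => /(_ M12 (lexx _)); rewrite /M2; have := kap0; lra.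
right; have := bad M1; rewrite !ler_expR => /(_ (lexx _) (ltW M21)).
by rewrite /M1 /M2; have := kap0; lra.
Qed.

(** No nonzero y is orthogonal to both f k and f (k+1) and their multiples by 'X,
and each of the two indices yields the same pair of alternatives at k+1. *)
Lemma dual_dichotomy k (y : nat -> int) x l :
  y 0 != 0 -> `|(y 0)%:~R : R| <= expR x ->
  (forall i, (i < 4)%N -> `|z ^+ i * (y 0)%:~R - (y i)%:~R| <= expR (- l)) ->
  l <= 3 * kap + 11 + L k.+1 \/ 2 * L k.+1 <= 3 * kap + 11 + x - l.
Proof.
move=> y0 y0x yl.
have no := fun k => @dual_nonorthogonal k y x l y0x yl.
have [/no[h|h]|] := boolP ((pair4 y (f k) != 0) || (pair4 y ('X * f k) != 0)).
- by left; have := qa_mono qa k; lra.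
- by right.
rewrite negb_or !negbK => /andP[/eqP f0 /eqP f1].
have [/no[h|h]|] := boolP ((pair4 y (f k.+1) != 0) || (pair4 y ('X * f k.+1) != 0)).
- by left.
- by right; have := qa_mono qa k.+1; lra.
rewrite negb_or !negbK => /andP[/eqP g0 /eqP g1].
have := pair4_eq0 (qa_size qa k) (qa_size qa k.+1) (qa_res_neq0 qa k) f0 f1 g0 g1.
by move=> /(_ 0 isT) h; move: y0; rewrite h eqxx.
Qed.

Lemma det4_sum (S : comNzRingType) (p q r : {poly S}) :
  det4 p q r = q`_0 * det4 p 'X^0 r + q`_1 * det4 p 'X^1 r
             + q`_2 * det4 p 'X^2 r + q`_3 * det4 p 'X^3 r.
Proof. by rewrite /det4 !coefXn /=; ring. Qed.

(** The vector y of values at the monomials of the integral functional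
P |-> det4 (f k.+1) P Q, where Q is f k times a linear form of size exp t.
The errors z ^+ i * y 0 - y i are the values at polynomials vanishing at z, hence
small by [det4_le]; they are all less than 1, so y 0 = 0 would force the functional to
vanish, whereas it does not vanish on f k and 'X * f k. *)
Lemma dual_points : exists2 K, 0 <= K &
  forall k t, 0 <= t <= L k.+2 - L k -> K < L k ->
  exists y : nat -> int,
    [/\ y 0 != 0, `|(y 0)%:~R : R| <= expR (K + 2 * L k.+1 + L k + t) &
        forall i, (i < 4)%N ->
          `|z ^+ i * (y 0)%:~R - (y i)%:~R| <= expR (K - L k - t)].
Proof.
have z01 := qa_z qa; have /andP[z0 z1] := z01.
(* exp 1000 exceeds the constants 324 and 540 that arise from [det4_le]. *)
exists (4 * kap + 1000); first by have := kap0; lra.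
move=> k t /andP[t0 tL] KL.
have [u [v [uv0 sQ HQ0 _ VQ]]] := linear_multiple qa k t0.
pose F := f k.+1; set Q := _ * f k in sQ HQ0 VQ.
have sF : (size F <= 3)%N by exact: (qa_size qa).
pose y i := det4 F 'X^i Q.
have HQ i : `|(toR R Q)`_i| <= 2 * expR (kap + L k + t) by rewrite coef_map; exact: HQ0.
have HF i : `|(toR R F)`_i| <= expR (kap + L k.+1).
  by rewrite coef_map; exact: (qa_coef qa).
have VF := qa_val_le qa k.+1; rewrite -/F in VF.
have [sF' sQ'] : (size (toR R F) <= 3)%N /\ (size (toR R Q) <= 4)%N.
  by rewrite !size_toR.
have DP (p : {poly R}) : (size p <= 4)%N -> (forall i, `|p`_i| <= 1) ->
   `|det4 (toR R F) p (toR R Q)| <= 216 * expR (3 * kap - 2 * L k.+2 + L k + t)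
      + 216 * `|p.[z]| * expR (3 * kap + 2 * L k.+1 + L k + t)
      + 108 * expR (4 * kap - L k - t).
  move=> sp hp; apply: le_trans (det4_le sF' sp sQ' z01 HF hp HQ) _.
  set G := expR (kap + L k + t); set pz := `|p.[z]|.
  have pz0 : 0 <= pz by exact: normr_ge0.
  have e1 : `|(toR R F).[z]| * expR (kap + L k.+1) * 1 * (2 * G)
      <= 2 * expR (3 * kap - 2 * L k.+2 + L k + t).
    have h := ler_wpM2r (expR_ge0 (kap + L k.+1 + (kap + L k + t))) VF.
    rewrite mulr1 mulrCA -!mulrA -expRD ler_pM2l //.
    apply: le_trans h _; rewrite -expRD ler_expR; lra.
  have e2 : expR (kap + L k.+1) * expR (kap + L k.+1) * G =
      expR (3 * kap + 2 * L k.+1 + L k + t).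
    by rewrite -!expRD; congr expR; ring.
  have e3 : expR (kap + L k.+1) * expR (kap + L k.+1) * `|(toR R Q).[z]| <=
      expR (4 * kap - L k - t).
    apply: le_trans (ler_wpM2l (mulr_ge0 (expR_ge0 _) (expR_ge0 _)) VQ) _.
    by rewrite -!expRD ler_expR; lra.
  rewrite -e2 mul1r [_ * (pz * _ + _)]mulrDr.
  rewrite (_ : expR (kap + L k.+1) * expR (kap + L k.+1) * (pz * (2 * G)) =
    2 * (pz * (expR (kap + L k.+1) * expR (kap + L k.+1) * G))); last by ring.
  rewrite -[216 * pz * _]mulrA; clear - e1 e3; lra.
have err i : (i < 4)%N ->
   `|z ^+ i * (y 0)%:~R - (y i)%:~R| <= expR (4 * kap + 1000 - L k - t).
  move=> i4.
  have -> : z ^+ i * (y 0)%:~R - (y i)%:~R =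
      det4 (toR R F) (z ^+ i *: 1 - 'X^i) (toR R Q).
    rewrite /y -!det4_map !map_polyXn expr0 /det4 !coefB !coefZ.
    by ring.
  have sp : (size (z ^+ i *: 1 - 'X^i : {poly R})%R <= 4)%N.
    rewrite (leq_trans (size_polyD _ _)) // geq_max size_polyN size_polyXn i4 andbT.
    by rewrite (leq_trans (size_scale_leq _ _)) // size_poly1.
  have hp j : `|(z ^+ i *: 1 - 'X^i : {poly R})`_j| <= 1.
    rewrite coefB coefZ coef1 coefXn.
    have zi0 : 0 <= z ^+ i by rewrite exprn_ge0.
    have zi1 : z ^+ i <= 1 by rewrite exprn_ile1.
    clear - zi0 zi1.
    by case: (j == 0%N); case: (j == i); rewrite /= ?mulr1n ?mulr0n ler_norml; lra.
  apply: le_trans (DP _ sp hp) _.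
  rewrite hornerD hornerN hornerZ hornerXn hornerC mulr1 subrr normr0 mulr0 mul0r addr0.
  have h : expR (3 * kap - 2 * L k.+2 + L k + t) <= expR (4 * kap - L k - t).
    by rewrite ler_expR; have := kap0; clear - tL; lra.
  have h2 : (324 : R) <= expR 1000.
    by apply: le_trans (ler_nat_expR R 1000); rewrite ler_nat.
  rewrite (_ : 4 * kap + 1000 - L k - t = 1000 + (4 * kap - L k - t)); last by ring.
  rewrite [expR (1000 + _)]expRD.
  have := ler_wpM2r (expR_ge0 (4 * kap - L k - t)) h2; clear - h; lra.
exists y; split=> //; last first.
  rewrite /y expr0 -det4_map.
  have map1 : toR R 1 = 1 by rewrite rmorph1.
  rewrite map1.
  have hp j : `|(1 : {poly R})`_j| <= 1.
    by rewrite coef1; case: eqP => _; rewrite ?normr1 ?normr0.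
  have s1 : (size (1 : {poly R})%R <= 4)%N by rewrite size_poly1.
  apply: le_trans (DP _ s1 hp) _; rewrite hornerC normr1 mulr1.
  set M := 3 * kap + 2 * L k.+1 + L k + t.
  have k0 := kap0; have L12 := qa_mono qa k; have L23 := qa_mono qa k.+1.
  have Lk1 : 0 <= L k by exact: (scale_ge0 qa).
  have h3 : expR (3 * kap - 2 * L k.+2 + L k + t) <= expR (kap + M).
    by rewrite ler_expR /M; clear - k0 L12 L23 Lk1 t0; lra.
  have h4 : expR (4 * kap - L k - t) <= expR (kap + M).
    by rewrite ler_expR /M; clear - k0 L12 L23 Lk1 t0; lra.
  have h5 : expR M <= expR (kap + M) by rewrite ler_expR lerDr.
  have h2 : (540 : R) <= expR 1000.
    by apply: le_trans (ler_nat_expR R 1000); rewrite ler_nat.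
  rewrite (_ : 4 * kap + 1000 + 2 * L k.+1 + L k + t = 1000 + (kap + M)); last by rewrite /M; ring.
  rewrite [expR (1000 + _)]expRD.
  have := ler_wpM2r (expR_ge0 (kap + M)) h2; clear - h3 h4 h5; lra.
apply/eqP => y00.
have yi0 i : (i < 4)%N -> y i = 0.
  move=> i4; apply/eqP; apply/negPn/negP => yi.
  have := err i i4; rewrite y00 mulr0 sub0r normrN.
  move=> /(le_trans (intr_norm_ge1 R yi)); apply/negP; rewrite -ltNge.
  by rewrite -[ltRHS]expR0 ltr_expR; clear - KL t0; lra.
have D0 p : det4 F p Q = 0.
  by rewrite det4_sum -!/(y _) !yi0 // !mulr0 !addr0.
have r0 : res22 F (f k) != 0.
  rewrite (_ : res22 F (f k) = res22 (f k) F) ?(qa_res_neq0 qa) //.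
  have f3 := coef_ge_size (qa_size qa k) (leqnn 3); have F3 := coef_ge_size sF (leqnn 3).
  by rewrite /res22 /det4 !coefXM /= f3 F3; ring.
have /eqP := D0 (f k); have /eqP := D0 ('X * f k).
rewrite (_ : det4 F ('X * f k) Q = - v * res22 F (f k)); last first.
  by rewrite /res22 /det4 !coef_linM !coefXM /=; ring.
rewrite (_ : det4 F (f k) Q = u * res22 F (f k)); last first.
  by rewrite /res22 /det4 !coef_linM !coefXM /=; ring.
rewrite !mulf_eq0 (negPf r0) !orbF oppr_eq0 => /eqP v0 /eqP u0.
by move: uv0; rewrite u0 v0 eqxx.
Qed.

End dual.

(** * Exponents on the exponential scale *)

Section translation.
Variable R : realType.
Implicit Types (x w z : R) (P : {poly int}).

Lemma powR_expR x w : expR x `^ w = expR (w * x).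
Proof. by rewrite /powR gt_eqF ?expR_gt0 // expRK. Qed.

Lemma exponent_sup_le (S : R -> Prop) r :
  (forall w, S w -> w <= r) -> (exponent_sup S <= r%:E)%E.
Proof.
by move=> Sr; apply: ge_ereal_sup => _ [w Sw <-]; rewrite lee_fin; exact: Sr.
Qed.

Lemma exponent_sup_ge (S : R -> Prop) r :
  (forall w, w < r -> S w) -> (r%:E <= exponent_sup S)%E.
Proof.
move=> rS; apply/lee_addgt0Pr => e e0.
have h : ((r - e)%:E <= exponent_sup S)%E.
  by apply: ereal_sup_ubound; exists (r - e) => //; apply: rS; lra.
by have := leeD2r e%:E h; rewrite -EFinD subrK.
Qed.

Lemma exponent_supE (S : R -> Prop) r :
  (forall w, S w -> w <= r) -> (forall w, w < r -> S w) ->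
  exponent_sup S = r%:E.
Proof.
move=> Sr rS; apply/eqP; rewrite eq_le.
by rewrite exponent_sup_le //= exponent_sup_ge.
Qed.

Lemma exponent_sup_pinfty (S : R -> Prop) :
  (forall w, S w) -> exponent_sup S = +oo%E.
Proof.
by move=> h; apply: eq_infty => r; apply: exponent_sup_ge.
Qed.

Lemma coef_le_height P x : (height P)%:R <= expR x ->
  forall i, `|(P`_i)%:~R : R| <= expR x.
Proof.
move=> hP i; apply: le_trans hP.
have [iP|Pi] := ltnP i (size P); last first.
  by rewrite nth_default // normr0 ler0n.
rewrite -intr_norm -abszE -pmulrn ler_nat.
exact: (leq_bigmax (Ordinal iP)).
Qed.

Lemma height_le P (B : R) : 0 <= B -> (forall i, `|(P`_i)%:~R : R| <= B) ->
  (height P)%:R <= B.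
Proof.
move=> B0 hP; rewrite /height; elim/big_ind: _ => //.
  by move=> m n mB nB; rewrite /maxn; case: ifP.
by move=> i _; have := hP i; rewrite -intr_norm -abszE -pmulrn.
Qed.

Lemma height_gt0 P : P != 0 -> 0 < ((height P)%:R : R).
Proof.
move=> P0; rewrite ltr0n.
have sP : ((size P).-1 < size P)%N by rewrite prednK // size_poly_gt0.
apply: leq_trans (leq_bigmax (Ordinal sP)).
by rewrite /= absz_gt0 -lead_coefE lead_coef_eq0.
Qed.

Lemma lambda_solvableP z lambda x : lambda_solvable 3 z lambda (expR x) <->
  exists y : nat -> int, [/\ y 0 != 0, `|(y 0)%:~R : R| <= expR x &
    forall i, (i < 4)%N ->
      `|z ^+ i * (y 0)%:~R - (y i)%:~R| <= expR (- (lambda * x))].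
Proof.
rewrite /lambda_solvable powR_expR mulNr; split=> [[x0 [y [/andP[x01 x0x] hy]]]|[y [y0 y0x hy]]].
  exists (fun i => if i is j.+1 then y (inord j) else x0); split=> //.
    by apply/eqP => e; move: x01; rewrite e mulr0z normr0 ler10.
  case=> [|i] i4; first by rewrite expr0 mul1r subrr normr0 expR_ge0.
  apply: le_trans hy.
  have := le_bigmax (0 : R) (fun i : 'I_3 => `|z ^+ i.+1 * x0%:~R - (y i)%:~R|) (inord i).
  by rewrite inordK.
exists (y 0), (fun i => y i.+1); split; first by rewrite intr_norm_ge1 ?y0x.
by apply: bigmax_le => [|i _]; [exact: expR_ge0|exact: (hy i.+1 (ltn_ord i))].
Qed.

(** Dividing by the content can only decrease the height. *)
Lemma int_minpoly_primitive (f : {poly int}) (alpha : R) :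
  f != 0 -> (size f <= 3)%N -> root (toR R f) alpha ->
  (forall Q : {poly int}, Q != 0 -> root (toR R Q) alpha -> (2 < size Q)%N) ->
  int_minpoly alpha (zprimitive f) /\
  forall i, `|((zprimitive f)`_i)%:~R : R| <= `|(f`_i)%:~R|.
Proof.
move=> f0 sf rf minf.
have c0 : zcontents f != 0 by rewrite zcontents_eq0.
split; first split.
- by rewrite zcontents_primitive f0.
- move: rf; rewrite {1}(zpolyEprim f) map_polyZ rootZ // intr_eq0 //.
- by move=> Q Q0 rQ; rewrite size_zprimitive (leq_trans sf) // minf.
move=> i; rewrite {2}(zpolyEprim f) coefZ intrM normrM ler_peMl //.
exact: intr_norm_ge1.
Qed.

Lemma root_cubic_value_le P z alpha H : (size P <= 4)%N -> 0 <= z <= 1 ->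
  `|alpha - z| <= 1 -> root (toR R P) alpha ->
  (forall i, `|(P`_i)%:~R : R| <= H) ->
  `|(toR R P).[z]| <= 11 * H * `|alpha - z|.
Proof.
move=> sP /andP[z0 z1] az /rootP ra hP.
have -> : (toR R P).[z] = ((P`_1)%:~R + (P`_2)%:~R * (z + alpha)
    + (P`_3)%:~R * (z ^+ 2 + z * alpha + alpha ^+ 2)) * (z - alpha).
  rewrite -[LHS]subr0 -ra !horner4 ?size_toR // !coef_map /=; ring.
rewrite normrM [`|z - alpha|]distrC; apply: ler_wpM2r; first exact: normr_ge0.
have [a1 a2] : -1 <= alpha /\ alpha <= 2.
  by move: az; rewrite ler_norml => /andP[? ?]; split; lra.
have na : `|alpha| <= 2 by rewrite ler_norml; apply/andP; split; lra.
have nz : `|z| <= 1 by rewrite ger0_norm.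
have h1 : `|z + alpha| <= 3 by have := ler_normDD nz na; lra.
have h2 : `|z ^+ 2 + z * alpha + alpha ^+ 2| <= 7.
  rewrite !expr2; have := ler_normDD (ler_normDD (ler_normM nz nz) (ler_normM nz na)) (ler_normM na na); lra.
have := ler_normDD (ler_normDD (hP 1) (ler_normM (hP 2) h1)) (ler_normM (hP 3) h2); lra.
Qed.

(** A good algebraic approximation gives a polynomial that is small at z; the
polynomial may vanish at z here, which is excluded later by the lower bounds. *)
Lemma wstar_solvable_value z w x : 0 <= z <= 1 -> 0 <= w -> 0 <= x ->
  wstar_solvable 3 z w (expR x) -> exists (alpha : R) (P : {poly int}),
    [/\ int_minpoly alpha P, P != 0, (size P <= 4)%N,
        (forall i, `|(P`_i)%:~R : R| <= expR x) &
        `|(toR R P).[z]| <= expR (11 - w * x)].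
Proof.
move=> z01 w0 x0 [alpha [P [mP sP hP az0 az]]]; exists alpha, P.
have [cP rP _] := mP.
have P0 : P != 0.
  by apply/eqP => P0; move: cP; rewrite P0 zcontents0.
have hP0 := height_gt0 P0.
have cf := coef_le_height hP.
split=> //.
rewrite powR_expR mulNr in az.
have H1 : 1 <= ((height P)%:R : R) by rewrite ler1n -(ltr0n R).
have az1 : `|alpha - z| <= 1.
  apply: le_trans az _; rewrite ler_pdivrMl // mulr1; apply: le_trans H1.
  by rewrite -[leRHS]expR0 ler_expR oppr_le0 mulr_ge0.
have hc i : `|(P`_i)%:~R : R| <= (height P)%:R.
  have := @coef_le_height P (ln (height P)%:R); rewrite lnK ?posrE // => /(_ (lexx _)).
  exact.
apply: le_trans (root_cubic_value_le sP z01 az1 rP hc) _.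
have h2 : 11 * (height P)%:R * `|alpha - z| <= 11 * expR (- (w * x)).
  rewrite -mulrA ler_pM2l // -ler_pdivlMl //.
apply: le_trans h2 _; rewrite expRD; apply: ler_wpM2r; first exact: expR_ge0.
exact: (ler_nat_expR R 11).
Qed.

Lemma large_expR (S : R -> Prop) :
  (forall x0, exists2 x, x0 <= x & S (expR x)) -> arbitrarily_large S.
Proof.
move=> h X0; have [x x0x Sx] := h X0; exists (expR x) => //.
by have := expR_ge1Dx x; lra.
Qed.

Lemma all_large_expR (S : R -> Prop) x0 :
  (forall x, x0 <= x -> S (expR x)) -> all_large S.
Proof.
move=> h; exists (expR x0) => X xX.
have X0 : 0 < X := lt_le_trans (expR_gt0 _) xX.
rewrite -(lnK (x := X)) ?posrE //; apply: h.
by rewrite -ler_expR lnK ?posrE.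
Qed.

Lemma arbitrarily_largeP (S : R -> Prop) : arbitrarily_large S ->
  forall x0, exists2 x, x0 <= x & S (expR x).
Proof.
move=> h x0; have [X xX SX] := h (expR x0).
have X0 : 0 < X := lt_le_trans (expR_gt0 _) xX.
exists (ln X); last by rewrite lnK ?posrE.
by rewrite -ler_expR lnK ?posrE.
Qed.

Lemma all_largeP (S : R -> Prop) : all_large S ->
  exists x0, forall x, x0 <= x -> S (expR x).
Proof.
move=> [X0 h]; exists X0 => x xX; apply: h.
by have := expR_ge1Dx x; lra.
Qed.

End translation.

(** * Exponents of a number with such a sequence *)

Section exponents.
Variables (R : realType) (z kap : R) (L : nat -> R) (f : nat -> {poly int}).
Variable sigma : R.
Hypothesis qa : quadratic_approximations z kap L f.
Hypothesis sigma01 : 0 <= sigma <= 1.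
Hypothesis ratio_ge : forall theta C, theta < sigma ->
  exists k0, forall k, (k0 <= k)%N -> C + theta * L k.+1 <= L k.
Hypothesis ratio_le : forall theta C k0, sigma < theta ->
  exists2 k, (k0 <= k)%N & C + L k <= theta * L k.+1.

(** The height exp x is compared with the index k for which L k <= x + K < L (k+1).
Both lower bounds of [cubic_value_ge] beat the exponent w as soon as
(w - 1) * L k exceeds 2 * L (k+1) by a constant, which [ratio_ge] provides for
theta = 2 / (w - 1) < sigma. *)
Lemma cubic_value_gt_eventually w C0 : 0 < sigma -> 1 + 2 / sigma < w ->
  exists x0, forall x, x0 <= x -> forall P : {poly int},
    P != 0 -> (size P <= 4)%N -> (forall i, `|(P`_i)%:~R : R| <= expR x) ->
    expR (C0 - w * x) < `|(toR R P).[z]|.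
Proof.
move=> s0 sw; have [K K0 cv] := cubic_value_ge qa.
have w1 : 2 < (w - 1) * sigma by rewrite -ltr_pdivrMr //; lra.
have wp : 0 < w - 1.
  by rewrite -(pmulr_lgt0 _ s0); lra.
pose theta := 2 / (w - 1).
have ts : theta < sigma by rewrite /theta ltr_pdivrMr // mulrC.
have tw : theta * (w - 1) = 2 by rewrite /theta divfK // gt_eqF.
pose C := (`|C0| + K + 1 + w * (K + 1)) / (w - 1).
have Cw : C * (w - 1) = `|C0| + K + 1 + w * (K + 1) by rewrite /C divfK // gt_eqF.
have [k0 hk0] := ratio_ge C ts.
exists (L k0 + K) => x xk0 P P0 sP hP.
have [|k k0k /andP[Lk Lk1]] := scale_bracket qa (k0 := k0) (x := x + K); first by lra.
have {}hk0 := hk0 _ k0k.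
have hw : C * (w - 1) + 2 * L k.+1 <= (w - 1) * L k.
  rewrite -tw; have := ler_wpM2r (ltW wp) hk0; lra.
have hx : (w - 1) * L k <= (w - 1) * x + (w - 1) * K.
  by rewrite -mulrDr; apply: ler_wpM2l; lra.
have LL := qa_mono qa k.
have nC := ler_norm C0.
have [|h|h] := cv k P x P0 sP hP; first by lra.
- apply: lt_le_trans h; rewrite ltr_expR; lra.
- apply: lt_le_trans h; rewrite ltr_expR; lra.
Qed.

(** At heights slightly below exp (L (k+1)), all lower bounds of [cubic_value_ge]
are, up to a constant, at least the inverse cube of the height. *)
Lemma cubic_value_gt_often w C0 x0 : 3 < w ->
  exists2 x, x0 <= x & forall P : {poly int},
    P != 0 -> (size P <= 4)%N -> (forall i, `|(P`_i)%:~R : R| <= expR x) ->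
    expR (C0 - w * x) < `|(toR R P).[z]|.
Proof.
move=> w3; have [K K0 cv] := cubic_value_ge qa.
pose B := (`|C0| + 4 * K + 5) / (w - 3).
have w3' : 0 < w - 3 by lra.
have Bw : B * (w - 3) = `|C0| + 4 * K + 5 by rewrite /B divfK // gt_eqF.
have [k0 hk0] := scale_eventually_ge qa (`|x0| + `|B| + K + 1).
have := hk0 k0.+1 (leqnSn k0) => LB.
have [nx nB nC] : [/\ x0 <= `|x0|, B <= `|B| & C0 <= `|C0|] by rewrite !ler_norm.
have [nx' nB'] : 0 <= `|x0| /\ 0 <= `|B| by rewrite !normr_ge0.
exists (L k0.+1 - K - 1); first by lra.
move=> P P0 sP hP; set x := L k0.+1 - K - 1 in hP *.
have xB : B <= x by rewrite /x; lra.
have hB : B * (w - 3) <= x * (w - 3) by apply: ler_wpM2r => //; lra.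
have LL := qa_mono qa k0.
have [|h|h] := cv k0 P x P0 sP hP; first by rewrite /x; lra.
- by apply: lt_le_trans h; rewrite ltr_expR; rewrite /x in hB *; lra.
- by apply: lt_le_trans h; rewrite ltr_expR; rewrite /x in hB *; lra.
Qed.

(** A multiple of f k by a good linear form serves for every height between
exp (L k) and exp (L (k+1)), because its value is about
exp (- 2 * L (k+1)) over its height. *)
Lemma w_hat_ge3 w : w < 3 -> all_large (w_solvable 3 z w).
Proof.
move=> w3; have k0 := qa_kap qa.
pose B := (5 * kap + 3) / (3 - w).
have w3' : 0 < 3 - w by lra.
have Bw : B * (3 - w) = 5 * kap + 3 by rewrite /B divfK // gt_eqF.
apply: (@all_large_expR _ _ (`|B| + L 0 + kap + 1)) => x x0.
have [nB nB'] : B <= `|B| /\ 0 <= `|B| by rewrite ler_norm normr_ge0.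
have L0 := qa_L0 qa.
have hB : B * (3 - w) <= x * (3 - w) by apply: ler_wpM2r; lra.
have [|k _ /andP[Lk Lk1]] := scale_bracket qa (k0 := 0) (x := x - kap - 1); first by lra.
have [|u [v [uv sQ hQ vQ0 vQ]]] := linear_multiple qa k (t := x - kap - 1 - L k); first by lra.
exists ((v%:P + u *: 'X) * f k); split=> //.
  apply: height_le; first exact: expR_ge0.
  move=> i; apply: le_trans (hQ i) _.
  have h2 : (2 : R) <= expR 1 by have := expR_ge1Dx (1 : R); lra.
  apply: le_trans (ler_wpM2r (expR_ge0 _) h2) _.
  by rewrite -expRD ler_expR; lra.
rewrite powR_expR; apply: le_trans vQ _; rewrite ler_expR; lra.
Qed.

Lemma quadratic_root_solves k w x : kap + L k <= x ->
  kap - 2 * L k - 2 * L k.+1 <= - (kap + L k) - w * x ->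
  wstar_solvable 3 z w (expR x).
Proof.
move=> xk hw.
have [alpha [ra az ma]] := qa_root qa k.
have f0 : f k != 0.
  apply/eqP => f0; have := qa_const qa k; rewrite f0 coef0 normr0.
  by rewrite leNgt expR_gt0.
have [mp cp] := int_minpoly_primitive f0 (qa_size qa k) ra ma.
have hP : (height (zprimitive (f k)))%:R <= expR (kap + L k).
  by apply: height_le; [exact: expR_ge0|move=> i; exact: le_trans (cp i) (qa_coef qa k i)].
have hP0 : 0 < ((height (zprimitive (f k)))%:R : R).
  by apply: height_gt0; rewrite zprimitive_eq0.
exists alpha, (zprimitive (f k)); split=> //.
- by rewrite size_zprimitive (leq_trans (qa_size qa k)).
- by apply: le_trans hP _; rewrite ler_expR.
- rewrite normr_gt0 subr_eq0; apply/eqP => azz; move: ra; rewrite azz => /rootP r0.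
  have := qa_val_ge qa k; rewrite r0 normr0.
  by rewrite leNgt expR_gt0.
- apply: le_trans az _; rewrite powR_expR.
  apply: (@le_trans _ _ (expR (- (kap + L k)) * expR (- w * x))).
    by rewrite -expRD ler_expR; lra.
  apply: ler_wpM2r; first exact: expR_ge0.
  by rewrite expRN lef_pV2 ?posrE ?expR_gt0.
Qed.

(** Both exponents come from f k and its root at height exp (kap + L k); for w > 1 the
index k is supplied by [ratio_le] with theta = 2 / (w - 1) > sigma. *)
Lemma w_exp_wstar_exp_ge w : 0 < w -> (w - 1) * sigma < 2 -> arbitrarily_large (w_solvable 3 z w)
  /\ arbitrarily_large (wstar_solvable 3 z w).
Proof.
move=> w0 w2; have k0 := qa_kap qa.
suff key : forall x0, exists k, [/\ x0 <= kap + L k,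
    kap - L k - 2 * L k.+1 <= - w * (kap + L k) &
    kap - 2 * L k - 2 * L k.+1 <= - (kap + L k) - w * (kap + L k)].
  split; apply: large_expR => x0; have [k [xk h1 h2]] := key x0; exists (kap + L k) => //.
    exists (f k); split.
    - by rewrite (leq_trans (qa_size qa k)).
    - by apply: height_le; [exact: expR_ge0|exact: (qa_coef qa)].
    - exact: lt_le_trans (expR_gt0 _) (qa_val_ge qa k).
    - by rewrite powR_expR; apply: le_trans (qa_val_le qa k) _; rewrite ler_expR.
  exact: (@quadratic_root_solves k).
move=> x0.
have [k1 hk1] := scale_eventually_ge qa (`|x0|).
pose C := 2 * kap + w * kap.
have C0 : 0 <= C by rewrite /C addr_ge0 // ?mulr_ge0 //; lra.
have [w1|w1] := lerP w 1.
  have [k2 hk2] := scale_eventually_ge qa C.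
  pose k := maxn k1 k2.
  have := hk1 k (leq_maxl _ _); have := hk2 k (leq_maxr _ _) => hC hx.
  have nx := ler_norm x0.
  have Lk := qa_mono qa k.
  have L0 : 0 <= L k by lra.
  have wL : w * L k <= L k by rewrite ler_piMl.
  by exists k; rewrite /C in hC; split; lra.
have w1' : 0 < w - 1 by lra.
pose theta := 2 / (w - 1).
have ts : sigma < theta by rewrite /theta ltr_pdivlMr // mulrC.
have tw : theta * (w - 1) = 2 by rewrite /theta divfK // gt_eqF.
have [k k1k hk] := ratio_le (C / (w - 1)) k1 ts.
exists k.
have hx := hk1 k k1k; have nx := ler_norm x0.
have L0 : 0 <= L k by have := normr_ge0 x0; lra.
have : C + (w - 1) * L k <= 2 * L k.+1.
  rewrite -tw; have := ler_wpM2r (ltW w1') hk.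
  by rewrite mulrDl divfK ?gt_eqF //; lra.
by rewrite /C; split; lra.
Qed.

(** Put l = lambda * x for the logarithm of the inverse error.  For the index with
L k <= l - K - 1 < L (k+1) the first alternative of [dual_dichotomy] fails.  The
second one contradicts [ratio_ge] for theta = (1 - lambda) / (2 * lambda) if
lambda < 1, and bounds L k otherwise. *)
Lemma lambda_unsolvable_eventually lambda : 1 / (1 + 2 * sigma) < lambda ->
  exists x0, forall x, x0 <= x -> ~ lambda_solvable 3 z lambda (expR x).
Proof.
move=> hl; have /andP[s0 s1] := sigma01.
have l1 : 1 < lambda * (1 + 2 * sigma) by rewrite -ltr_pdivrMr //; lra.
have l0 : 0 < lambda by apply: lt_trans hl; rewrite divr_gt0 //; lra.
pose K := 3 * kap + 11; have K0 : 0 <= K by rewrite /K; have := qa_kap qa; lra.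
pose theta := (1 - lambda) / (2 * lambda).
have ts : theta < sigma by rewrite /theta ltr_pdivrMr; lra.
have tl : theta * (2 * lambda) = 1 - lambda by rewrite /theta divfK //; lra.
have [k0 hk0] := ratio_ge ((K + 2 + lambda * K) / (2 * lambda)) ts.
have [k1 hk1] := scale_eventually_ge qa (K + 1).
pose k2 := (maxn k0 k1).+1.
exists ((`|L k2| + K + 1) / lambda) => x; rewrite ler_pdivrMr // => xx.
move=> /lambda_solvableP [y [y0 y0x hy]].
have [|k k2k /andP[Lk Lk1]] := scale_bracket qa (k0 := k2) (x := lambda * x - K - 1).
  by have := ler_norm (L k2); lra.
case: k k2k Lk Lk1 => // k k2k Lk Lk1.
have kk0 : (k0 <= k.+1)%N by rewrite (leq_trans (leq_maxl k0 k1)) // (leq_trans (leqnSn _)).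
have kk1 : (k1 <= k.+1)%N by rewrite (leq_trans (leq_maxr k0 k1)) // (leq_trans (leqnSn _)).
have [h|h] := dual_dichotomy qa k y0 y0x hy.
  by rewrite /K in Lk; lra.
rewrite -/K in h.
have Lk0 := hk1 _ kk1.
have [l2|l2] := lerP 1 lambda.
  have : x <= lambda * x.
    rewrite ler_peMl //; rewrite -(pmulr_rge0 _ l0); lra.
  by lra.
have h1 : lambda * (2 * L k.+1) <= lambda * (K + x - lambda * x) by rewrite ler_pM2l.
have h2 : (1 - lambda) * (lambda * x) <= (1 - lambda) * (L k.+2 + K + 1).
  by apply: ler_wpM2l; lra.
have h3 := ler_wpM2r (ltW (mulr_gt0 (ltr0n R 2) l0)) (hk0 _ kk0).
rewrite mulrDl divfK ?gt_eqF // in h3; last by lra.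
rewrite (_ : theta * L k.+2 * (2 * lambda) = (1 - lambda) * L k.+2) in h3; last first.
  by rewrite -tl; ring.
have : 0 <= lambda * K by rewrite mulr_ge0 // ltW.
lra.
Qed.

(** The size x is chosen so that the first alternative of [dual_dichotomy] just
fails at the index k; the second one then bounds L k. *)
Lemma lambda_unsolvable_often lambda x0 : 1 / 3 < lambda ->
  exists2 x, x0 <= x & ~ lambda_solvable 3 z lambda (expR x).
Proof.
move=> hl.
have l0 : 0 < lambda by lra.
pose K := 3 * kap + 11; have K0 : 0 <= K by rewrite /K; have := qa_kap qa; lra.
pose m := lambda^-1.
have lm : lambda * m = 1 by rewrite /m mulfV // gt_eqF.
have m3 : m < 3 by rewrite /m -(invrK 3) ltf_pV2 ?posrE //; lra.
have m0 : 0 < m by rewrite invr_gt0.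
pose B := (K + 2 * (K + 1)) / (3 - m).
have Bm : B * (3 - m) = K + 2 * (K + 1) by rewrite /B divfK // gt_eqF //; lra.
have [k0 hk0] := scale_eventually_ge qa (lambda * `|x0| + `|B| + 1).
have Lk := hk0 k0.+1 (leqnSn _).
have nB := ler_norm B; have nB' := normr_ge0 B; have nx := ler_norm x0.
have lx0 : lambda * x0 <= lambda * `|x0| by rewrite ler_pM2l.
exists (m * (L k0.+1 + K + 1)).
  rewrite -(ler_pM2l l0) mulrA lm mul1r; lra.
move=> /lambda_solvableP [y [y0 y0x hy]].
have [h|h] := dual_dichotomy qa k0 y0 y0x hy.
  by rewrite mulrA lm mul1r /K in h; lra.
rewrite mulrA lm mul1r -/K in h.
have hB : B * (3 - m) < L k0.+1 * (3 - m).
  have := mulr_ge0 (ltW l0) (normr_ge0 x0) => lx; rewrite ltr_pM2r; lra.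
have : m * (K + 1) <= 3 * (K + 1) by apply: ler_wpM2r; lra.
lra.
Qed.

(** The longest linear factor allowed in [dual_points], t = L (k+2) - L k, gives
size exp (2 * L (k+1) + L (k+2)) and error exp (- L (k+2)). *)
Lemma lambda_exp_ge lambda : 0 < lambda -> lambda * (1 + 2 * sigma) < 1 ->
  arbitrarily_large (lambda_solvable 3 z lambda).
Proof.
move=> l0 l1; have [K K0 dp] := dual_points qa.
apply: large_expR => x0.
pose theta := (1 - lambda) / (2 * lambda).
have l20 : 0 < 2 * lambda by lra.
have ts : sigma < theta by rewrite /theta ltr_pdivlMr; lra.
have tl : theta * (2 * lambda) = 1 - lambda by rewrite /theta divfK //; lra.
have [k0 hk0] := scale_eventually_ge qa (`|x0| + K + 1).
have [k k0k hk] := ratio_le ((K + lambda * K) / (2 * lambda)) k0.+1 ts.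
case: k k0k hk => // k k0k hk.
have Lk := hk0 k k0k.
have nx := ler_norm x0; have nx' := normr_ge0 x0.
have [L1 L2] := (qa_mono qa k, qa_mono qa k.+1).
have [||y [y0 y0x hy]] := dp k (L k.+2 - L k); [by lra|by lra|].
exists (K + 2 * L k.+1 + L k.+2); first by lra.
apply/lambda_solvableP; exists y; split=> //.
  by apply: le_trans y0x _; rewrite ler_expR; lra.
move=> i i4; apply: le_trans (hy i i4) _; rewrite ler_expR.
have h3 := ler_wpM2r (ltW l20) hk.
rewrite mulrDl divfK ?gt_eqF // in h3.
rewrite (_ : theta * L k.+2 * (2 * lambda) = (1 - lambda) * L k.+2) in h3; last first.
  by rewrite -tl; ring.
lra.
Qed.

(** Between sizes of about exp (3 * L (k+1)) and exp (3 * L (k+2)) the factor t in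
[dual_points] is first adapted to the size and then kept at its maximum. *)
Lemma lambda_hat_ge lambda : 0 < lambda < 1 / 3 ->
  all_large (lambda_solvable 3 z lambda).
Proof.
move=> /andP[l0 l3]; have [K K0 dp] := dual_points qa.
have d0 : 0 < 1 / 3 - lambda by lra.
pose B := (2 * K) / (1 / 3 - lambda).
have Bd : B * (1 / 3 - lambda) = 2 * K by rewrite /B divfK // gt_eqF.
have [k0 hk0] := scale_eventually_ge qa (K + 1).
apply: (@all_large_expR _ _ (`|B| + K + 3 * L k0.+1)) => x xx.
have nB := ler_norm B; have nB' := normr_ge0 B.
have Lk0 := hk0 _ (leqnSn k0).
have hB : B * (1 / 3 - lambda) <= x * (1 / 3 - lambda).
  by apply: ler_wpM2r; lra.
have [|k k0k /andP[Lk Lk1]] := scale_bracket qa (k0 := k0.+1) (x := (x - K) / 3); first by lra.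
case: k k0k Lk Lk1 => // k k0k Lk Lk1.
have KL := hk0 k k0k.
have [L1 L2] := (qa_mono qa k, qa_mono qa k.+1).
apply/lambda_solvableP.
have [xs|xs] := lerP x (K + 2 * L k.+1 + L k.+2).
  have [||y [y0 y0x hy]] := dp k (x - K - 2 * L k.+1 - L k); [by lra|by lra|].
  exists y; split=> //.
    by apply: le_trans y0x _; rewrite ler_expR; lra.
  by move=> i i4; apply: le_trans (hy i i4) _; rewrite ler_expR; lra.
have [||y [y0 y0x hy]] := dp k (L k.+2 - L k); [by lra|by lra|].
exists y; split=> //.
  by apply: le_trans y0x _; rewrite ler_expR; lra.
by move=> i i4; apply: le_trans (hy i i4) _; rewrite ler_expR; lra.
Qed.

(** The root of f k is used for all heights between exp (L k) and
exp (L (k+1)); it is weakest at the end of this range. *)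
Lemma wstar_hat_ge w : 0 < w < 2 + sigma -> all_large (wstar_solvable 3 z w).
Proof.
move=> /andP[w0 w2]; have k0 := qa_kap qa.
have ts : w - 2 < sigma by lra.
have [k1 hk1] := ratio_ge (2 * kap + w * kap) ts.
apply: (@all_large_expR _ _ (kap + L k1)) => x xx.
have [|k k1k /andP[Lk Lk1]] := scale_bracket qa (k0 := k1) (x := x - kap); first by lra.
have hk := hk1 k k1k.
apply: (quadratic_root_solves (k := k)); first by lra.
have : w * x <= w * (kap + L k.+1) by rewrite ler_pM2l //; lra.
lra.
Qed.

(** A minimal polynomial that is a multiple of f k by a linear factor is a constant
multiple of f k: its root is a root of the linear factor or of f k, and
minimality of the degree rules out the first case.  So, unlike a general multiple,
it is not smaller at z than f k. *)
Lemma minpoly_multiple_value k (alpha : R) (P : {poly int}) (u0 u1 : int) :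
  int_minpoly alpha P -> P != 0 ->
  res22 (f k) (f k.+1) *: P = (u0%:P + u1 *: 'X) * f k ->
  expR (- 2 * kap - L k - 2 * L k.+1) <= `|(toR R P).[z]|.
Proof.
move=> [_ rP minP] P0 E.
have D0 := qa_res_neq0 qa k; have DK := qa_res_le qa k.
set D := res22 _ _ in E D0 DK.
have f3 := coef_ge_size (qa_size qa k) (leqnn 3).
have f2 : (f k)`_2 != 0.
  by rewrite -(intr_eq0 R) (expR_norm_gt0 (qa_lead qa k)).
have A0 : u0%:P + u1 *: 'X != 0.
  apply/eqP => A0; move/eqP: E; rewrite A0 mul0r.
  by rewrite -size_poly_eq0 size_scale // size_poly_eq0 (negPf P0).
have E2 : D * P`_2 = u0 * (f k)`_2 + u1 * (f k)`_1 by rewrite -coefZ E coef_linM.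
have E3 : D * P`_3 = u1 * (f k)`_2 by rewrite -coefZ E coef_linM /= f3 mulr0 add0r.
have u10 : P`_3 = 0 -> u1 = 0.
  by move=> P3; apply/eqP; move/eqP: E3; rewrite P3 mulr0 eq_sym mulf_eq0 (negPf f2) orbF.
have : root (toR R (D *: P)) alpha by rewrite map_polyZ rootZ ?intr_eq0.
rewrite E toRM rootM => /orP[rA|rf].
  have sP : (size P <= 2)%N.
    apply: leq_trans (minP _ A0 rA) _.
    rewrite addrC (leq_trans (size_polyD _ _)) // geq_max.
    by rewrite (leq_trans (size_scale_leq _ _)) ?size_polyX // (leq_trans (size_polyC_leq1 _)).
  have u1e := u10 (coef_ge_size sP (isT : (2 <= 3)%N)).
  have : u0 = 0.
    apply/eqP; move/eqP: E2; rewrite (coef_ge_size sP (leqnn 2)) mulr0 u1e mul0r addr0.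
    by rewrite eq_sym mulf_eq0 (negPf f2) orbF.
  by move=> u0e; move: A0; rewrite u1e u0e scale0r addr0 polyC0 eqxx.
have f0 : f k != 0 by apply/eqP => f0; move: f2; rewrite f0 coef0 eqxx.
have sP : (size P <= 3)%N := leq_trans (minP _ f0 rf) (qa_size qa k).
have u1e := u10 (coef_ge_size sP (leqnn 3)).
have u0n : u0 != 0.
  by apply: contraNneq A0 => u0e; rewrite u1e u0e scale0r addr0 polyC0.
have EV : D%:~R * (toR R P).[z] = u0%:~R * (toR R (f k)).[z].
  rewrite -hornerZ -map_polyZ /= E u1e scale0r addr0 mul_polyC map_polyZ hornerZ //.
have h : `|(toR R (f k)).[z]| <= `|D%:~R * (toR R P).[z]|.
  by rewrite EV normrM ler_peMl // intr_norm_ge1.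
rewrite normrM in h.
have h2 := le_trans (le_trans (qa_val_ge qa k) h) (ler_wpM2r (normr_ge0 _) DK).
rewrite -(ler_pM2l (expR_gt0 kap)) (le_trans _ h2) // -expRD ler_expR; lra.
Qed.

(** At heights slightly below exp (L (k+1)) every competitor is either worse than
the root of f k, or is a root of f k itself. *)
Lemma wstar_unsolvable_often w x0 : 2 + sigma < w ->
  exists2 x, x0 <= x & ~ wstar_solvable 3 z w (expR x).
Proof.
move=> ws; have k0 := qa_kap qa; have /andP[s0 _] := sigma01.
have [K K0 tri] := cubic_value_trichotomy qa.
have ts : sigma < w - 2 by lra.
have [k1 hk1] := scale_eventually_ge qa (`|x0| + K + 1).
have [k k1k hk] := ratio_le (12 + K + w * (K + 1) + 2 * kap) k1 ts.
have Lk1 := hk1 _ (leqW k1k).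
have nx := ler_norm x0; have nx' := normr_ge0 x0.
have LL := qa_mono qa k.
pose x := L k.+1 - K - 1.
have xE : w * x = w * L k.+1 - w * (K + 1) by rewrite /x; ring.
exists x; first by rewrite /x; lra.
have [w0 xp] : 0 <= w /\ 0 <= x by rewrite /x; split; lra.
move=> /(wstar_solvable_value (qa_z qa) w0 xp)[alpha [P [mP P0 sP hP vP]]].
have [h|h|[u0 [u1 E]]] := tri k P x sP hP.
- by move: h; rewrite /x; lra.
- have := le_trans h vP; rewrite ler_expR xE; lra.
- have := le_trans (minpoly_multiple_value mP P0 E) vP; rewrite ler_expR xE; lra.
Qed.

Lemma w_solvable_value w x : w_solvable 3 z w (expR x) -> exists P : {poly int},
  [/\ P != 0, (size P <= 4)%N, (forall i, `|(P`_i)%:~R : R| <= expR x) &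
      `|(toR R P).[z]| <= expR (- (w * x))].
Proof.
move=> [P [sP hP vP0 vP]]; exists P; split=> //.
- by apply: contraTneq vP0 => ->; rewrite rmorph0 horner0 normr0 ltxx.
- exact: coef_le_height.
- by move: vP; rewrite powR_expR mulNr.
Qed.

Lemma cubic_exponents :
  [/\ w_exp 3 z = one_plus_two_over sigma /\
      wstar_exp 3 z = one_plus_two_over sigma,
      lambda_exp 3 z = (1 / (1 + 2 * sigma))%:E,
      w_hat 3 z = 3%:E,
      lambda_hat 3 z = (1 / 3)%:E &
      wstar_hat 3 z = (2 + sigma)%:E].
Proof.
have /andP[s0 s1] := sigma01.
have mono_pow (w w' X : R) : w <= w' -> 1 <= X -> X `^ (- w') <= X `^ (- w).
  by move=> ww X1; apply: ler_powR => //; rewrite lerN2.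
have w_le w w' X : w <= w' -> 1 <= X -> w_solvable 3 z w' X -> w_solvable 3 z w X.
  move=> ww X1 [P [h1 h2 h3 h4]]; exists P; split=> //.
  exact: le_trans h4 (mono_pow _ _ _ ww X1).
have ws_le w w' X : w <= w' -> 1 <= X -> wstar_solvable 3 z w' X -> wstar_solvable 3 z w X.
  move=> ww X1 [alpha [P [h1 h2 h3 h4 h5]]]; exists alpha, P; split=> //.
  by apply: le_trans h5 _; apply: ler_wpM2l; [rewrite invr_ge0 ler0n|exact: mono_pow].
have l_le w w' X : w <= w' -> 1 <= X -> lambda_solvable 3 z w' X -> lambda_solvable 3 z w X.
  move=> ww X1 [x0 [y [h1 h2]]]; exists x0, y; split=> //.
  exact: le_trans h2 (mono_pow _ _ _ ww X1).
have al_le (S S' : R -> Prop) : (forall X, 1 <= X -> S' X -> S X) ->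
    arbitrarily_large S' -> arbitrarily_large S.
  move=> h aS X0; have [X X0X SX] := aS (Num.max 1 X0).
  by exists X; [|apply: h => //]; apply: le_trans X0X; rewrite le_max lexx ?orbT.
have ll_le (S S' : R -> Prop) : (forall X, 1 <= X -> S' X -> S X) ->
    all_large S' -> all_large S.
  move=> h [X0 aS]; exists (Num.max 1 X0) => X; rewrite ge_max => /andP[X1 X0X].
  by apply: h => //; apply: aS.
have lower w : (w - 1) * sigma < 2 -> arbitrarily_large (w_solvable 3 z w) /\
    arbitrarily_large (wstar_solvable 3 z w).
  move=> hw; have [w0|w0] := ltrP 0 w; first exact: (w_exp_wstar_exp_ge).
  have [|h1 h2] := w_exp_wstar_exp_ge (w := 1) ltr01; first by rewrite subrr mul0r.
  split; [apply: al_le h1|apply: al_le h2] => X X1.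
    by apply: w_le => //; lra.
  by apply: ws_le => //; lra.
have upper_w w : 0 < sigma -> arbitrarily_large (w_solvable 3 z w) -> w <= 1 + 2 / sigma.
  move=> sp /arbitrarily_largeP aS; rewrite leNgt; apply/negP => hw.
  have [x0 up] := cubic_value_gt_eventually 0 sp hw.
  have [x xx0 /w_solvable_value[P [P0 sP hP vP]]] := aS x0.
  by have := up x xx0 P P0 sP hP; rewrite sub0r ltNge vP.
have upper_ws w : 0 < sigma -> arbitrarily_large (wstar_solvable 3 z w) -> w <= 1 + 2 / sigma.
  move=> sp /arbitrarily_largeP aS; rewrite leNgt; apply/negP => hw.
  have [x0 up] := cubic_value_gt_eventually 11 sp hw.
  have [x] := aS (Num.max 0 x0); rewrite ge_max => /andP[xp xx0].
  have w0 : 0 <= w by apply: le_trans (ltW hw); rewrite addr_ge0 // divr_ge0.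
  move=> /(wstar_solvable_value (qa_z qa) w0 xp)[alpha [P [_ P0 sP hP vP]]].
  by have := up x xx0 P P0 sP hP; rewrite ltNge vP.
have lt_sigma w : 0 < sigma -> w < 1 + 2 / sigma -> (w - 1) * sigma < 2.
  by move=> sp hw; rewrite -ltr_pdivlMr //; lra.
split; first split.
- rewrite /one_plus_two_over; case: eqP => [se|/eqP sn].
    apply: exponent_sup_pinfty => w; apply: (proj1 (lower w _)).
    by rewrite se mulr0.
  have sp : 0 < sigma by rewrite lt_neqAle eq_sym sn.
  apply: exponent_supE => w; first exact: upper_w.
  by move=> /(lt_sigma _ sp)/lower[].
- rewrite /one_plus_two_over; case: eqP => [se|/eqP sn].
    apply: exponent_sup_pinfty => w; apply: (proj2 (lower w _)).
    by rewrite se mulr0.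
  have sp : 0 < sigma by rewrite lt_neqAle eq_sym sn.
  apply: exponent_supE => w; first exact: upper_ws.
  by move=> /(lt_sigma _ sp)/lower[].
- have sp : 0 < 1 + 2 * sigma by lra.
  apply: exponent_supE => w.
    move=> /arbitrarily_largeP aS; rewrite leNgt; apply/negP => hw.
    have [x0 up] := lambda_unsolvable_eventually hw.
    by have [x xx0] := aS x0; exact: up.
  move=> hw; pose w' := Num.max w (1 / 4).
  have w14 : 1 / 4 < 1 / (1 + 2 * sigma) by rewrite ltr_pdivlMr //; lra.
  have ww' : w <= w' by rewrite /w' le_max lexx.
  apply: (@al_le _ (lambda_solvable 3 z w')) => [X X1|]; first exact: l_le.
  apply: (lambda_exp_ge).
    by rewrite /w' lt_max; apply/orP; right; lra.
  by rewrite -ltr_pdivlMr // /w' gt_max hw.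
- apply: exponent_supE => w.
    move=> /all_largeP[x0 aS]; rewrite leNgt; apply/negP => hw.
    have [x xx0 up] := cubic_value_gt_often 0 x0 hw.
    have [P [P0 sP hP vP]] := w_solvable_value (aS x xx0).
    by have := up P P0 sP hP; rewrite sub0r ltNge vP.
  exact: (w_hat_ge3).
- apply: exponent_supE => w.
    move=> /all_largeP[x0 aS]; rewrite leNgt; apply/negP => hw.
    have [x xx0 up] := lambda_unsolvable_often x0 hw.
    exact: up (aS x xx0).
  move=> hw; pose w' := Num.max w (1 / 4).
  have ww' : w <= w' by rewrite /w' le_max lexx.
  apply: (@ll_le _ (lambda_solvable 3 z w')) => [X X1|]; first exact: l_le.
  apply: (lambda_hat_ge); apply/andP; split.
    by rewrite /w' lt_max; apply/orP; right; lra.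
  by rewrite /w' gt_max hw /=; lra.
- apply: exponent_supE => w.
    move=> /all_largeP[x0 aS]; rewrite leNgt; apply/negP => hw.
    have [x xx0 up] := wstar_unsolvable_often x0 hw.
    exact: up (aS x xx0).
  move=> hw; pose w' := Num.max w 1.
  have ww' : w <= w' by rewrite /w' le_max lexx.
  apply: (@ll_le _ (wstar_solvable 3 z w')) => [X X1|]; first exact: ws_le.
  apply: wstar_hat_ge; apply/andP; split.
    by rewrite /w' lt_max ltr01 orbT.
  by rewrite /w' gt_max hw /=; lra.
Qed.

End exponents.

(** * Infinite continued fractions *)

Section cfrac_limits.
Local Open Scope classical_set_scope.
Local Open Scope ring_scope.
Variable R : realType.

Definition pos_seq (c : nat -> nat) := forall n, (0 < c n)%N.
Definition tail_seq (c : nat -> nat) n := c n.+1.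

Lemma cfrac_cons x l : cfrac R (x :: l) = (x%:R + cfrac R l)^-1.
Proof. by []. Qed.

Lemma cfrac01 l : all (fun x => 0 < x)%N l -> 0 <= cfrac R l <= 1.
Proof.
elim: l => [|x l IH] /=; first by rewrite lexx ler01.
move=> /andP[x0 /IH /andP[h0 h1]].
have x1 : 1 <= (x%:R : R) by rewrite ler1n.
rewrite invr_ge0 addr_ge0 //=.
by rewrite invf_le1; lra.
Qed.

Lemma mkseqSl (c : nat -> nat) n : mkseq c n.+1 = c 0 :: mkseq (tail_seq c) n.
Proof. by rewrite /mkseq /= -[1%N]addn0 iotaDl -map_comp. Qed.

Lemma cfrac_mkseq01 c n : pos_seq c -> 0 <= cfrac R (mkseq c n) <= 1.
Proof. by move=> hc; apply: cfrac01; apply/allP => x /mapP[i _ ->]. Qed.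

(** Two steps of the expansion contract distances by the factor 1/4 at least; the
constant 1/2 is enough for convergence. *)
Lemma cfrac_contract c j n m : pos_seq c ->
  `|cfrac R (mkseq c (j.*2 + n)) - cfrac R (mkseq c (j.*2 + m))| <= 2^-1 ^+ j.
Proof.
elim: j c => [|j IH] c hc.
  have := cfrac_mkseq01 n hc; have := cfrac_mkseq01 m hc.
  by rewrite expr0 ler_norml !add0n => /andP[? ?] /andP[? ?]; apply/andP; split; lra.
rewrite doubleS !addSn !mkseqSl !cfrac_cons.
have hc' : pos_seq (tail_seq (tail_seq c)) by move=> i; exact: hc.
have := IH _ hc'.
have := cfrac_mkseq01 (j.*2 + n) hc'; have := cfrac_mkseq01 (j.*2 + m) hc'.
set u := cfrac R _; set v := cfrac R _ => /andP[u0 u1] /andP[v0 v1] h.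
have c1 : 1 <= ((tail_seq c 0)%:R : R) by rewrite ler1n hc.
have c0 : 1 <= ((c 0)%:R : R) by rewrite ler1n hc.
set p := (tail_seq c 0)%:R in c1 *; set q := (c 0)%:R in c0 *.
have pu : 0 < p + u by lra.
have pv : 0 < p + v by lra.
have e : (q + (p + v)^-1)^-1 - (q + (p + u)^-1)^-1 =
    (v - u) / ((q * (p + v) + 1) * (q * (p + u) + 1)).
  have qv : q * (p + v) + 1 != 0 by rewrite gt_eqF // addr_gt0 // mulr_gt0 //; lra.
  have qu : q * (p + u) + 1 != 0 by rewrite gt_eqF // addr_gt0 // mulr_gt0 //; lra.
  by field; rewrite qv qu !gt_eqF.
rewrite e normrM exprS mulrC; apply: ler_pM => //.
have w2 (w : R) : 0 <= w -> 2 <= q * (p + w) + 1.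
  move=> w0; have : 1 * (p + w) <= q * (p + w) by apply: ler_wpM2r; lra.
  by lra.
have [a b] := (w2 _ u0, w2 _ v0).
have ab : 2 * 1 <= (q * (p + v) + 1) * (q * (p + u) + 1) by apply: ler_pM; lra.
rewrite ger0_norm ?invr_ge0; last by lra.
by rewrite lef_pV2 ?posrE; lra.
Qed.

Lemma cfrac_cvg c : pos_seq c -> cvgn (fun n => cfrac R (mkseq c n)).
Proof.
move=> hc; apply/cauchy_cvgP; apply: cauchy_exP => e e0.
have [j hj] : exists j, (2^-1 : R) ^+ j < e.
  have : (fun n => (2^-1 : R) ^+ n) @ \oo --> (0 : R).
    by apply: cvg_expr; rewrite ger0_norm ?invr_ge0 // invf_lt1 // ltr1n.
  move=> /cvgr0Pnorm_lt /(_ _ e0)[N _ hN].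
  by exists N; have := hN N (leqnn N) => /=; rewrite ger0_norm // exprn_ge0 // invr_ge0.
exists (cfrac R (mkseq c (j.*2 + 0))).
exists j.*2 => // n /= jn; rewrite -(subnKC jn).
exact: le_lt_trans (cfrac_contract j 0 (n - j.*2) hc) hj.
Qed.

Lemma cfrac_lim_cvg c : pos_seq c ->
  (fun n => cfrac R (mkseq c n)) @ \oo --> cfrac_lim R c.
Proof. exact: cfrac_cvg. Qed.

Lemma cfrac_lim01 c : pos_seq c -> 0 <= cfrac_lim R c <= 1.
Proof.
move=> hc; apply/andP; split.
  apply: limr_ge; first exact: cfrac_cvg.
  by apply: nearW => n; case/andP: (cfrac_mkseq01 n hc).
apply: limr_le; first exact: cfrac_cvg.
by apply: nearW => n; case/andP: (cfrac_mkseq01 n hc).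
Qed.

Lemma cfrac_lim_shift c : pos_seq c ->
  cfrac_lim R c = ((c 0)%:R + cfrac_lim R (tail_seq c))^-1.
Proof.
move=> hc; have hc' : pos_seq (tail_seq c) by move=> n; exact: hc.
apply: cvg_lim => //.
rewrite -(cvg_shiftS (fun n => cfrac R (mkseq c n))).
under eq_fun do rewrite mkseqSl cfrac_cons.
apply: cvgV.
  have /andP[h _] := cfrac_lim01 hc'.
  by rewrite gt_eqF // ltr_wpDr // ltr0n.
by apply: cvgD; [exact: cvg_cst|exact: cfrac_lim_cvg].
Qed.

End cfrac_limits.

(** * Words as products of matrices *)

Definition mx22 (p q r s : int) : 'M[int]_2 :=
  \matrix_(i, j) if i == 0 then (if j == 0 then p else q)
                 else (if j == 0 then r else s).

Definition letter_mx (c : nat) : 'M[int]_2 := mx22 c%:Z 1 1 0.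
Definition word_mx (w : seq nat) : 'M[int]_2 := \prod_(c <- w) letter_mx c.
Definition det22 (A : 'M[int]_2) : int := A 0 0 * A 1 1 - A 0 1 * A 1 0.

Lemma mx22M (A B : 'M[int]_2) i j : (A * B) i j = A i 0 * B 0 j + A i 1 * B 1 j.
Proof.
rewrite -mulmxE mxE !big_ord_recl big_ord0 addr0.
by congr (_ * _ + A i _ * B _ j); apply/val_inj.
Qed.

Lemma det22M A B : det22 (A * B) = det22 A * det22 B.
Proof. by rewrite /det22 !mx22M; ring. Qed.

Lemma det22_mx22 p q r s : det22 (mx22 p q r s) = p * s - q * r.
Proof. by rewrite /det22 !mxE. Qed.

Lemma word_mx_cons c w : word_mx (c :: w) = letter_mx c * word_mx w.
Proof. by rewrite /word_mx big_cons. Qed.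

Lemma word_mx_cat u v : word_mx (u ++ v) = word_mx u * word_mx v.
Proof. by rewrite /word_mx big_cat. Qed.

Lemma word_mx_rcons w c : word_mx (rcons w c) = word_mx w * letter_mx c.
Proof. by rewrite -cats1 word_mx_cat [X in _ * X]/word_mx big_seq1. Qed.

Lemma word_mx_flatten n w : word_mx (flatten (nseq n w)) = word_mx w ^+ n.
Proof.
elim: n => [|n IH]; first by rewrite /word_mx /= big_nil expr0.
by rewrite [flatten _]/= word_mx_cat IH exprS.
Qed.

Lemma det22_word w : `|det22 (word_mx w)| = 1.
Proof.
elim: w => [|c w IH].
  by rewrite /word_mx big_nil /det22 !mxE.
by rewrite word_mx_cons det22M normrM IH det22_mx22 mulr0 !mulr1.
Qed.

(** Inequalities that hold for products of matrices A_c, the empty product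
included.  The last one makes the family stable under left multiplication by
A_c. *)
Record cone_mx (A : 'M[int]_2) : Prop := ConeMx {
  cone_00 : 1 <= A 0 0;
  cone_01 : 0 <= A 0 1 <= A 0 0;
  cone_10 : 0 <= A 1 0 <= A 0 0;
  cone_11 : 0 <= A 1 1 <= A 0 0;
  cone_rows : A 0 1 + A 1 1 <= A 0 0 + A 1 0
}.

Definition pos_word (w : seq nat) := all (fun c => 0 < c)%N w.

Lemma word_cone w : pos_word w -> cone_mx (word_mx w).
Proof.
elim: w => [_|c w IH /= /andP[c0 /IH []]].
  by rewrite /word_mx big_nil; split; rewrite !mxE.
rewrite word_mx_cons; set A := word_mx w => a0 a1 a2 a3 a4.
have c1 : 1 <= c%:Z by lia.
have cA0 : 1 * A 0 0 <= c%:Z * A 0 0 by apply: ler_wpM2r => //; lia.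
have cA1 : 1 * A 0 1 <= c%:Z * A 0 1 by apply: ler_wpM2r => //; lia.
have cA : (c%:Z - 1) * A 0 1 <= (c%:Z - 1) * A 0 0 by apply: ler_wpM2l; lia.
by split; rewrite !mx22M !mxE /=; lia.
Qed.

(** For nonempty products the four entries are comparable up to the constant B:
the first letter controls the first column and the last letter the first row. *)
Record open_cone_mx (B : int) (A : 'M[int]_2) : Prop := OpenConeMx {
  open_cone_cone : cone_mx A;
  open_01 : 1 <= A 0 1;
  open_10 : 1 <= A 1 0;
  open_11_10 : A 1 1 <= A 1 0;
  open_11_01 : A 1 1 <= A 0 1;
  open_00_01 : A 0 0 <= B * A 0 1;
  open_00_10 : A 0 0 <= B * A 1 0
}.

Lemma word_open_cone (B : nat) w : pos_word w -> w != [::] ->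
  all (fun c => c.+1 <= B)%N w -> open_cone_mx B%:Z (word_mx w).
Proof.
move=> pw; have cw := word_cone pw; case: w pw cw => // c w pw cw _ bw.
have [h10 [h11 h00]] : 1 <= word_mx (c :: w) 1 0 /\
    word_mx (c :: w) 1 1 <= word_mx (c :: w) 1 0 /\
    word_mx (c :: w) 0 0 <= B%:Z * word_mx (c :: w) 1 0.
  move: pw bw => /= /andP[c0 /word_cone[]].
  rewrite word_mx_cons; set A := word_mx w => a0 a1 a2 a3 a4 /andP[cB _].
  have : c.+1%:Z * A 0 0 <= B%:Z * A 0 0 by apply: ler_wpM2r; lia.
  by rewrite !mx22M !mxE /=; lia.
move: pw cw bw h10 h11 h00; rewrite lastI; move: (belast c w) (last c w) => {c}w c.
rewrite /pos_word !all_rcons => /andP[c0 /word_cone[]] a0 a1 a2 a3 a4 cw /andP[cB _] h10 h11 h00.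
split=> //; move: a0 a1 a2 a3 a4; rewrite word_mx_rcons; set A := word_mx w;
  rewrite !mx22M !mxE /= => a0 a1 a2 a3 a4; try lia.
have : c.+1%:Z * A 0 0 <= B%:Z * A 0 0 by apply: ler_wpM2r; lia.
lia.
Qed.

(** The vector (1, zeta) is proportional to A (1, t), where t is the tail of the
expansion. *)
Lemma cfrac_direction (R : realType) (c : nat -> nat) n : pos_seq c ->
  let A := word_mx (mkseq c n) in
  exists2 t : R, 0 <= t <= 1 &
    cfrac_lim R c * ((A 0 0)%:~R + (A 0 1)%:~R * t)
    = (A 1 0)%:~R + (A 1 1)%:~R * t.
Proof.
elim: n c => [|n IH] c hc A.
  exists (cfrac_lim R c); first exact: cfrac_lim01.
  by rewrite /A /word_mx big_nil !mxE /=; ring.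
have hc' : pos_seq (tail_seq c) by move=> i; exact: hc.
have [t t01 E] := IH _ hc'; exists t => //.
have /andP[x0 x1] := cfrac_lim01 R hc'.
rewrite cfrac_lim_shift // /A mkseqSl word_mx_cons !mx22M !mxE /=.
have c1 : 1 <= ((c 0)%:R : R) by rewrite ler1n hc.
move: E x0 x1; set u := word_mx _; set x := cfrac_lim R _ => E x0 x1.
have cx : (c 0)%:R + x != 0 by rewrite gt_eqF //; lra.
apply: (canLR (mulKf cx)).
rewrite !mul1r !mul0r !addr0 [RHS]mulrDl E !rmorphD !rmorphM /=.
by rewrite -[(c 0)%:~R]/((c 0)%:R : R); ring.
Qed.

(** * Linear forms in a number with bounded partial quotients *)

Section bounded_quotients.
Variables (R : realType) (c : nat -> nat) (B : nat).
Hypotheses (pc : pos_seq c) (cB : forall n, (c n < B)%N).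

Let Q n := word_mx (mkseq c n).
Local Notation z := (cfrac_lim R c).
Local Notation q n := ((Q n 0 0)%:~R : R).
Local Notation p n := ((Q n 1 0)%:~R : R).

Let Q_cone n : cone_mx (Q n).
Proof. by apply: word_cone; apply/allP => x /mapP[i _ ->]; exact: pc. Qed.

Let QS n : Q n.+1 = Q n * letter_mx (c n).
Proof. by rewrite /Q mkseqS word_mx_rcons. Qed.

Lemma convergent_denom_ge1 n : 1 <= q n.
Proof. by rewrite ler1z; exact: cone_00 (Q_cone n). Qed.

Lemma convergent_denom_le n : q n.+1 <= B%:R * q n.
Proof.
have [h0 /andP[h1 h2] _ _ _] := Q_cone n.
suff : Q n.+1 0 0 <= B%:Z * Q n 0 0 by rewrite -(ler_int R) rmorphM.
rewrite QS mx22M !mxE /=.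
have : (c n).+1%:Z * Q n 0 0 <= B%:Z * Q n 0 0.
  by apply: ler_wpM2r; [lia|have := cB n; lia].
lia.
Qed.

Lemma convergent_denom_mono n : q n <= q n.+1.
Proof.
have [h0 /andP[h1 h2] _ _ _] := Q_cone n.
suff : Q n 0 0 <= Q n.+1 0 0 by rewrite -(ler_int R).
rewrite QS mx22M !mxE /=.
have : Q n 0 0 * 1 <= Q n 0 0 * (c n)%:Z.
  by apply: ler_wpM2l; [lia|have := pc n; lia].
lia.
Qed.

Lemma convergent_denom_ge n : n%:R <= q n.
Proof.
have incr m : q m.+1 + 1 <= q m.+2.
  have [h0 _ _ _ _] := Q_cone m; have [k0 _ _ _ _] := Q_cone m.+1.
  suff : Q m.+1 0 0 + 1 <= Q m.+2 0 0 by rewrite -(ler_int R) rmorphD.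
  rewrite [Q m.+2]QS mx22M !mxE /= {3}QS mx22M !mxE /=.
  have : Q m.+1 0 0 * 1 <= Q m.+1 0 0 * (c m.+1)%:Z.
    by apply: ler_wpM2l; [lia|have := pc m.+1; lia].
  lia.
case: n => [|n]; first by rewrite (le_trans ler01) // convergent_denom_ge1.
elim: n => [|n IH]; first exact: convergent_denom_ge1.
by rewrite -natr1; apply: le_trans (incr n); rewrite lerD2r.
Qed.

Lemma convergent_error n : `|q n * z - p n| <= (q n)^-1.
Proof.
have [t /andP[t0 t1] E] := cfrac_direction R n pc.
have [h0 /andP[h1 h2] _ _ _] := Q_cone n.
rewrite -/(Q n) in E.
have q1 := convergent_denom_ge1 n.
have d1 : `|(det22 (Q n))%:~R| = 1 :> R by rewrite -intr_norm det22_word.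
have Q01 : 0 <= ((Q n 0 1)%:~R : R) by rewrite ler0z.
have Q01t : 0 <= (Q n 0 1)%:~R * t by exact: mulr_ge0.
have e : (q n * z - p n) * (q n + (Q n 0 1)%:~R * t) = t * (det22 (Q n))%:~R.
  by rewrite mulrBl -mulrA E /det22; ring.
have h : `|q n * z - p n| * (q n + (Q n 0 1)%:~R * t) <= 1.
  have d0 : 0 <= q n + (Q n 0 1)%:~R * t by lra.
  have := congr1 Num.norm e.
  by rewrite !normrM d1 mulr1 (ger0_norm d0) (ger0_norm t0) => ->.
have h' : `|q n * z - p n| * q n <= 1.
  apply: le_trans h; apply: ler_wpM2l; first exact: normr_ge0.
  lra.
by rewrite -(ler_pM2r (lt_le_trans ltr01 q1)) mulVf // gt_eqF // (lt_le_trans ltr01).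
Qed.

Lemma convergent_bracket x : 1 <= x -> exists n, q n <= x < q n.+1.
Proof.
move=> x1; have q0 : q 0 = 1 by rewrite /Q /word_mx big_nil mxE.
have ex : exists n, x < q n.
  exists (Num.bound x); apply: lt_le_trans (convergent_denom_ge _).
  by apply: archi_boundP; lra.
have [[|n] xn minn] := ex_minnP ex; first by rewrite q0 in xn; lra.
exists n; rewrite xn andbT leNgt; apply/negP => /minn; by rewrite ltnn.
Qed.

(** Two consecutive convergents with denominators between 2x and a bounded multiple
of x: the linear form cannot vanish at both of them, and where it does not vanish
it takes an integer value, so it is not small at z. *)
Lemma badly_approximable (u v : int) (x : R) : (u != 0) || (v != 0) ->
  `|u%:~R : R| <= x -> `|v%:~R : R| <= x ->
  1 <= 4 * B%:R ^+ 2 * x * `|u%:~R * z + v%:~R|.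
Proof.
move=> uv ux vx.
have x1 : 1 <= x.
  case/orP: uv => h; [apply: le_trans ux|apply: le_trans vx];
    by rewrite -intr_norm ler1z -gtz0_ge1 normr_gt0.
have [|n /andP[qn qn1]] := convergent_bracket (x := 2 * x); first lra.
have q2 := convergent_denom_mono n.+1.
have B0 : 0 <= (B%:R : R) by [].
have qB : q n.+1 <= B%:R ^+ 2 * (2 * x) /\ q n.+2 <= B%:R ^+ 2 * (2 * x).
  have h1 := convergent_denom_le n; have h2 := convergent_denom_le n.+1.
  have h3 : B%:R * q n <= B%:R * (2 * x) by exact: ler_wpM2l.
  have h4 : B%:R * q n.+1 <= B%:R * (B%:R * (2 * x)) by apply: ler_wpM2l => //; lra.
  by rewrite expr2; split; lra.
have key m : 2 * x < q m -> q m <= B%:R ^+ 2 * (2 * x) ->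
    (Q m 0 0 * v + Q m 1 0 * u) != 0 ->
    1 <= 4 * B%:R ^+ 2 * x * `|u%:~R * z + v%:~R|.
  move=> qm1 qm2 nz.
  have i1 : 1 <= `|(Q m 0 0 * v + Q m 1 0 * u)%:~R : R|.
    by rewrite -intr_norm ler1z -gtz0_ge1 normr_gt0.
  have e : (Q m 0 0 * v + Q m 1 0 * u)%:~R =
      q m * (u%:~R * z + v%:~R) - u%:~R * (q m * z - p m) :> R by ring.
  have qm0 : 0 < q m by lra.
  have h1 : `|u%:~R * (q m * z - p m)| <= 1 / 2.
    rewrite normrM; apply: le_trans (ler_pM _ _ ux (convergent_error m)) _ => //.
    by rewrite ler_pdivrMr //; lra.
  have h2 : 1 <= q m * `|u%:~R * z + v%:~R| + 1 / 2.
    apply: le_trans i1 _; rewrite e; apply: le_trans (ler_normB _ _) _.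
    by rewrite normrM (gtr0_norm qm0) lerD2l.
  have h3 : q m * `|u%:~R * z + v%:~R| <= B%:R ^+ 2 * (2 * x) * `|u%:~R * z + v%:~R|.
    exact: ler_wpM2r.
  lra.
have [h1|h1] := eqVneq (Q n.+1 0 0 * v + Q n.+1 1 0 * u) 0; last first.
  by apply: (key n.+1) => //; case: qB.
have [h2|h2] := eqVneq (Q n.+2 0 0 * v + Q n.+2 1 0 * u) 0; last first.
  by apply: (key n.+2) => //; [lra|case: qB].
have dn : det22 (Q n.+2) != 0.
  by rewrite -normr_gt0 det22_word.
have [e1 e2] : Q n.+2 0 1 = Q n.+1 0 0 /\ Q n.+2 1 1 = Q n.+1 1 0.
  by rewrite (QS n.+1) !mx22M !mxE /=; split; ring.
have v0 : det22 (Q n.+2) * v = 0.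
  rewrite (_ : _ * v = Q n.+1 1 0 * (Q n.+2 0 0 * v + Q n.+2 1 0 * u)
    - Q n.+2 1 0 * (Q n.+1 0 0 * v + Q n.+1 1 0 * u)); first by rewrite h1 h2; ring.
  by rewrite /det22 e1 e2; ring.
have u0 : det22 (Q n.+2) * u = 0.
  rewrite (_ : _ * u = Q n.+2 0 0 * (Q n.+1 0 0 * v + Q n.+1 1 0 * u)
    - Q n.+1 0 0 * (Q n.+2 0 0 * v + Q n.+2 1 0 * u)); first by rewrite h1 h2; ring.
  by rewrite /det22 e1 e2; ring.
move/eqP: v0; move/eqP: u0; rewrite !mulf_eq0 (negPf dn) /= => /eqP u0 /eqP v0.
by move: uv; rewrite u0 v0 eqxx.
Qed.

Lemma linear_approximation (x : R) : 1 <= x -> exists u v : int,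
  [/\ (u != 0) || (v != 0), `|u%:~R : R| <= x, `|v%:~R : R| <= x &
      `|u%:~R * z + v%:~R| <= B%:R / x].
Proof.
move=> x1; have [n /andP[qn qn1]] := convergent_bracket x1.
have [h0 /andP[h1 h2] /andP[h3 h4] _ _] := Q_cone n.
have q1 := convergent_denom_ge1 n.
exists (Q n 0 0), (- Q n 1 0); split.
- by apply/orP; left; lia.
- by rewrite ger0_norm //; lra.
- rewrite rmorphN normrN ger0_norm ?ler0z //; apply: le_trans qn.
  by rewrite ler_int.
- rewrite rmorphN; apply: le_trans (convergent_error n) _.
  have := convergent_denom_le n => h.
  have q0 : 0 < q n by lra.
  rewrite ler_pdivlMr; last lra.
  by rewrite mulrC ler_pdivrMr //; lra.
Qed.

End bounded_quotients.

(** * Quadratic polynomials attached to Sturmian words *)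

(** Its value at T is the determinant of (1, T) and A (1, T); so its roots are the
fixed points of A as a homography. *)
Definition fixed_poly (A : 'M[int]_2) : {poly int} :=
  Poly [:: A 1 0; A 1 1 - A 0 0; - A 0 1].

Lemma size_fixed_poly A : (size (fixed_poly A) <= 3)%N.
Proof. exact: size_Poly. Qed.

Lemma coef_fixed_poly A :
  ((fixed_poly A)`_0 = A 1 0) * ((fixed_poly A)`_1 = A 1 1 - A 0 0) *
  ((fixed_poly A)`_2 = - A 0 1).
Proof. by rewrite !coef_Poly. Qed.

Lemma horner_fixed_poly (R : realType) A (z : R) :
  (toR R (fixed_poly A)).[z] =
  (A 1 0)%:~R + ((A 1 1)%:~R - (A 0 0)%:~R) * z - (A 0 1)%:~R * z ^+ 2.
Proof.
rewrite horner3 ?(leq_trans (size_poly _ _)) ?size_fixed_poly //.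
by rewrite !coef_map !coef_fixed_poly /=; ring.
Qed.

(** Two matrices share a fixed point when their commutator is singular. *)
Lemma res22_fixed_poly A B :
  res22 (fixed_poly A) (fixed_poly B) = - det22 (A * B - B * A).
Proof.
have c3 M : (fixed_poly M)`_3 = 0 by rewrite coef_Poly.
have E M N i j : (M - N : 'M[int]_2) i j = M i j - N i j by rewrite !mxE.
by rewrite /res22 /det4 !coefXM /= !c3 !coef_fixed_poly /det22 !E !mx22M; ring.
Qed.

Lemma all_flatten_nseq (T : Type) (p : pred T) n w :
  all p w -> all p (flatten (nseq n w)).
Proof. by move=> pw; elim: n => //= n IH; rewrite all_cat pw IH. Qed.

Section sturmian.
Variables (a b : nat) (s : nat -> nat).
Hypotheses (ha : (0 < a)%N) (hb : (0 < b)%N).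
Hypothesis (hs : forall k : nat, (0 < k)%N -> (0 < s k)%N).

Local Notation word := (sturmian_word a b s).
Local Notation c := (sturmian_limit_word a b s).
Definition sturmian_mx k := word_mx (word k).
Local Notation W := sturmian_mx.

Lemma sturmian_word_all (p : pred nat) k : p a -> p b -> all p (word k).
Proof.
move=> pa pb; suff: all p (word k) && all p (word k.+1) by case/andP.
elim: k => [|k /andP[IH0 IH1]].
  by rewrite /= pb all_rcons pa all_nseq pb orbT.
by rewrite IH1 sturmian_wordSS all_cat IH0 all_flatten_nseq.
Qed.

Lemma sturmian_mx_cone k : open_cone_mx (a + b).+1%:Z (W k).
Proof.
apply: word_open_cone.
- exact: sturmian_word_all.
- by case: (sturmian_word_size a b hs k) => h _; case: (word k) h.
- by apply: sturmian_word_all; lia.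
Qed.

Lemma sturmian_word_pre k d : exists r, word (k.+1 + d) = word k.+1 ++ r.
Proof.
elim: d => [|d [r IH]]; first by exists [::]; rewrite addn0 cats0.
have [t e] := sturmian_word_prefix a b hs (k + d).
by exists (r ++ t); rewrite catA -IH addnS -addSn e.
Qed.

Lemma sturmian_word_mkseq k u r : word k.+1 = u ++ r -> u = mkseq c (size u).
Proof.
move=> E; apply: (@eq_from_nth _ b); rewrite ?size_mkseq // => i iu.
rewrite nth_mkseq //.
have [_ <-] := sturmian_limit_wordP a b hs (ltn_addl k.+1 (ltnSn i) : (i < k.+1 + i.+1)%N).
have [t' e'] := sturmian_word_pre k i.+1.
by rewrite e' E -catA nth_cat iu.
Qed.

Lemma sturmian_word_next k : exists r, word k.+3 = (word k.+2 ++ word k.+1) ++ r.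
Proof.
rewrite sturmian_wordSS; have : (0 < s k.+3)%N by exact: hs.
case: (s k.+3) => // -[|n] _.
  by exists [::]; rewrite /= !cats0.
have [t e] := sturmian_word_pre k 1; rewrite addn1 in e.
rewrite (_ : flatten (nseq n.+2 (word k.+2)) =
  word k.+2 ++ word k.+2 ++ flatten (nseq n (word k.+2))) // {2}e.
by eexists; rewrite -!catA.
Qed.

Lemma sturmian_mxSS k : W k.+2 = W k.+1 ^+ s k.+2 * W k.
Proof. by rewrite /W sturmian_wordSS word_mx_cat word_mx_flatten. Qed.

(** The words m_(k+1) m_k and m_k m_(k+1) differ by an exchange of their last two
letters only.  The exchange alternates with the parity of k, which is why two cases
are needed. *)
Lemma sturmian_mx_swap k : exists P : 'M[int]_2, `|det22 P| = 1 /\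
  let Aab := letter_mx a * letter_mx b in let Aba := letter_mx b * letter_mx a in
  (W k.+1 * W k = P * Aab /\ W k * W k.+1 = P * Aba) \/
  (W k.+1 * W k = P * Aba /\ W k * W k.+1 = P * Aab).
Proof.
elim: k => [|k [P [dP IH]]].
  exists (word_mx (nseq (s 1).-1 b)); split; first exact: det22_word.
  left; rewrite /W /= word_mx_rcons -!mulrA.
  rewrite [word_mx [:: b]]/word_mx big_seq1; split=> //.
  rewrite mulrA -[letter_mx b * word_mx _]word_mx_cons.
  rewrite (_ : b :: nseq (s 1).-1 b = rcons (nseq (s 1).-1 b) b).
    by rewrite word_mx_rcons mulrA.
  by elim: (s 1).-1 => //= n {1}->.
exists (W k.+1 ^+ s k.+2 * P); split.
  rewrite det22M normrM dP mulr1.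
  elim: (s k.+2) => [|n IHn]; first by rewrite expr0 /det22 !mxE.
  by rewrite exprS det22M normrM IHn det22_word.
have e1 : W k.+2 * W k.+1 = W k.+1 ^+ s k.+2 * (W k * W k.+1).
  by rewrite sturmian_mxSS mulrA.
have e2 : W k.+1 * W k.+2 = W k.+1 ^+ s k.+2 * (W k.+1 * W k).
  by rewrite sturmian_mxSS !mulrA -exprS exprSr.
move=> Aab Aba; rewrite e1 e2.
by case: IH => -[-> ->]; [right|left]; rewrite !mulrA.
Qed.

Lemma sturmian_res k :
  `|res22 (fixed_poly (W k)) (fixed_poly (W k.+1))| = (a%:Z - b%:Z) ^+ 2.
Proof.
have E M N i j : (M - N : 'M[int]_2) i j = M i j - N i j by rewrite !mxE.
have dd : det22 (letter_mx a * letter_mx b - letter_mx b * letter_mx a)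
    = (a%:Z - b%:Z) ^+ 2.
  by rewrite /det22 !E !mx22M !mxE /=; ring.
have dd' : det22 (letter_mx b * letter_mx a - letter_mx a * letter_mx b)
    = (a%:Z - b%:Z) ^+ 2.
  by rewrite /det22 !E !mx22M !mxE /=; ring.
rewrite res22_fixed_poly normrN.
have [P [dP [[-> ->]|[-> ->]]]] := sturmian_mx_swap k;
  by rewrite -mulrBr det22M normrM dP mul1r ?dd ?dd' ger0_norm // sqr_ge0.
Qed.

End sturmian.

Lemma cone_mul_00 (A X : 'M[int]_2) : cone_mx A -> cone_mx X ->
  A 0 0 * X 0 0 <= (A * X) 0 0 <= 2 * (A 0 0 * X 0 0).
Proof.
move=> [a0 a1 a2 a3 a4] [x0 x1 x2 x3 x4]; rewrite mx22M.
have : 0 <= A 0 1 * X 1 0 <= A 0 0 * X 0 0.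
  case/andP: a1 => a10 a11; case/andP: x2 => x20 x21.
  by rewrite mulr_ge0 // ler_pM.
lia.
Qed.

(** The determinant of A_p A_q (1, t) and A_q A_p (X, Y). *)
Definition letter_wedge (R : realType) (p q t X Y : R) : R :=
  (p * q + 1 + p * t) * (p * X + Y) - (q + t) * ((p * q + 1) * X + q * Y).

Lemma letter_wedge_upper (R : realType) (p q t X Y : R) :
  1 <= p -> 1 <= q -> 0 <= t <= 1 -> 0 <= Y <= X ->
  `|letter_wedge p q t X Y| <= (p + q + 1) ^+ 3 * X.
Proof.
move=> p1 q1 /andP[t0 t1] /andP[Y0 YX].
have X0 : 0 <= X := le_trans Y0 YX.
have [p0 q0] : 0 <= p /\ 0 <= q by split; exact: le_trans ler01 _.
have pq : 1 <= p * q by rewrite -[leLHS]mulr1 ler_pM.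
set w := p + q + 1.
have w2 : w ^+ 2 = p * p + q * q + 2 * (p * q) + 2 * p + 2 * q + 1 by rewrite /w; ring.
have [pp qq] : 0 <= p * p /\ 0 <= q * q by rewrite !mulr_ge0.
have pt : p * t <= p by rewrite ler_piMr.
have pt0 : 0 <= p * t by exact: mulr_ge0.
have pX : 0 <= p * X by exact: mulr_ge0.
have qX : 0 <= q * X by exact: mulr_ge0.
have qY : q * Y <= q * X by exact: ler_wpM2l.
have qY0 : 0 <= q * Y by exact: mulr_ge0.
have pqX : 0 <= (p * q + 1) * X by rewrite mulr_ge0 // addr_ge0 // mulr_ge0.
have wX : w * X = p * X + q * X + X by rewrite /w; ring.
have le1 : (p * q + 1 + p * t) * (p * X + Y) <= w ^+ 2 * (w * X).
  by apply: ler_pM; rewrite ?w2 ?wX; clear w2 wX; lra.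
have le2 : (q + t) * ((p * q + 1) * X + q * Y) <= w * (w ^+ 2 * X).
  apply: ler_pM; rewrite /w; [by lra|by lra|by lra|].
  apply: (@le_trans _ _ ((p * q + 1 + q) * X)); first by rewrite [leRHS]mulrDl lerD2l.
  by apply: ler_wpM2r => //; rewrite -/w w2; lra.
have ge1 : 0 <= (p * q + 1 + p * t) * (p * X + Y).
  by rewrite mulr_ge0 ?addr_ge0 // mulr_ge0.
have ge2 : 0 <= (q + t) * ((p * q + 1) * X + q * Y) by rewrite mulr_ge0 ?addr_ge0.
have w3 : w ^+ 2 * (w * X) = w ^+ 3 * X by ring.
have w3' : w * (w ^+ 2 * X) = w ^+ 3 * X by ring.
rewrite w3 in le1; rewrite w3' in le2.
have dist (u v K : R) : u <= K -> v <= K -> 0 <= u -> 0 <= v -> `|u - v| <= K.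
  by move=> uK vK u0 v0; rewrite ler_norml; apply/andP; split; clear - uK vK u0 v0; lra.
exact: dist.
Qed.

Lemma letter_wedge_gt (R : realType) (p q t X Y : R) :
  1 <= q -> q + 1 <= p -> 0 <= t -> 0 <= Y -> 0 <= X ->
  X <= letter_wedge p q t X Y.
Proof.
move=> q1 qp t0 Y0 X0.
have -> : letter_wedge p q t X Y =
    X * ((p * q + 1) * (p - q) + t * (p * (p - q) - 1))
    + Y * (q * (p - q) + 1 + t * (p - q)) by rewrite /letter_wedge; ring.
have d1 : 1 <= p - q by lra.
have [p1 q0] : 1 <= p /\ 0 <= q by lra.
have h2 : 1 <= p * (p - q) by rewrite -[leLHS]mulr1 ler_pM.
have h3 : 0 <= q * (p - q) by rewrite mulr_ge0 // (le_trans ler01).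
have h4 : 1 <= (p * q + 1) * (p - q).
  rewrite -[leLHS]mulr1 ler_pM // lerDr mulr_ge0 //; exact: le_trans p1.
have h5 : 0 <= t * (p * (p - q) - 1) by rewrite mulr_ge0 // subr_ge0.
have h6 : 0 <= t * (p - q) by rewrite mulr_ge0 // (le_trans ler01).
apply: (@le_trans _ _ (X * ((p * q + 1) * (p - q) + t * (p * (p - q) - 1)))).
  by rewrite ler_peMr // (le_trans h4) // lerDl.
by rewrite lerDl mulr_ge0 // !addr_ge0.
Qed.

Lemma letter_wedge_lt (R : realType) (p q t X Y : R) :
  1 <= p -> p + 1 <= q -> 0 <= t -> 0 <= Y -> 0 <= X ->
  X <= - letter_wedge p q t X Y.
Proof.
move=> p1 pq t0 Y0 X0.
have -> : - letter_wedge p q t X Y =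
    X * ((p * q + 1) * (q - p) + t * (p * (q - p) + 1))
    + Y * (q * (q - p) - 1 + t * (q - p)) by rewrite /letter_wedge; ring.
have d1 : 1 <= q - p by lra.
have [q1 p0] : 1 <= q /\ 0 <= p by lra.
have h2 : 0 <= p * (q - p) by rewrite mulr_ge0 // (le_trans ler01).
have h3 : 1 <= q * (q - p) by rewrite -[leLHS]mulr1 ler_pM.
have h4 : 1 <= (p * q + 1) * (q - p).
  rewrite -[leLHS]mulr1 ler_pM // lerDr mulr_ge0 //; exact: le_trans q1.
have h5 : 0 <= t * (p * (q - p) + 1) by rewrite mulr_ge0 // addr_ge0.
have h6 : 0 <= t * (q - p) by rewrite mulr_ge0 // (le_trans ler01).
apply: (@le_trans _ _ (X * ((p * q + 1) * (q - p) + t * (p * (q - p) + 1)))).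
  by rewrite ler_peMr // (le_trans h4) // lerDl.
by rewrite lerDl mulr_ge0 // addr_ge0 // subr_ge0.
Qed.

(** Expansions starting with a, b and with b, a are separated by a positive
constant when a and b differ. *)
Lemma letter_wedge_le (R : realType) (a b : nat) (t X Y : R) :
  (0 < a)%N -> (0 < b)%N -> a <> b -> 0 <= t <= 1 -> 0 <= Y <= X ->
  X <= `|letter_wedge a%:R b%:R t X Y| <= (a + b).+1%:R ^+ 3 * X.
Proof.
move=> a0 b0 ab t01 YX.
have [a1 b1] : 1 <= (a%:R : R) /\ 1 <= (b%:R : R) by rewrite !ler1n.
have -> : (a + b).+1%:R = a%:R + b%:R + 1 :> R by rewrite -natr1 natrD.
rewrite letter_wedge_upper // andbT.
have [/andP[t0 _] /andP[Y0 YX']] := (t01, YX); have X0 := le_trans Y0 YX'.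
have [lt|gt|//] := ltngtP a b.
  rewrite -normrN; apply: le_trans (ler_norm _).
  by apply: letter_wedge_lt; rewrite // natr1 ler_nat.
apply: le_trans (ler_norm _).
by apply: letter_wedge_gt; rewrite // natr1 ler_nat.
Qed.

(** With x and z * x the coordinates of U (1, t), the left side is the determinant
of U (1, t) and M U (1, t).  As M U = V M, it is also the determinant of
P A (1, t) and P A' M (1, t), and P factors out. *)
Lemma fixed_poly_wedge (R : realType) (M U V P A A' : 'M[int]_2) (z t : R) :
  U = P * A -> V = P * A' -> M * U = V * M ->
  let x := (U 0 0)%:~R + (U 0 1)%:~R * t in
  let X := (M 0 0)%:~R + (M 0 1)%:~R * t in
  let Y := (M 1 0)%:~R + (M 1 1)%:~R * t in
  z * x = (U 1 0)%:~R + (U 1 1)%:~R * t ->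
  x ^+ 2 * (toR R (fixed_poly M)).[z] = (det22 P)%:~R *
    (((A 0 0)%:~R + (A 0 1)%:~R * t) * ((A' 1 0)%:~R * X + (A' 1 1)%:~R * Y)
     - ((A 1 0)%:~R + (A 1 1)%:~R * t) * ((A' 0 0)%:~R * X + (A' 0 1)%:~R * Y)).
Proof.
move=> eU eV eM x X Y zx.
have -> : x ^+ 2 * (toR R (fixed_poly M)).[z] =
    x * ((M 1 0)%:~R * x + (M 1 1)%:~R * (z * x))
    - (z * x) * ((M 0 0)%:~R * x + (M 0 1)%:~R * (z * x)).
  by rewrite horner_fixed_poly; ring.
rewrite zx.
have e0 : (M 0 0)%:~R * x + (M 0 1)%:~R * ((U 1 0)%:~R + (U 1 1)%:~R * t) =
    ((V * M) 0 0)%:~R + ((V * M) 0 1)%:~R * t.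
  by rewrite -eM !mx22M /x; ring.
have e1 : (M 1 0)%:~R * x + (M 1 1)%:~R * ((U 1 0)%:~R + (U 1 1)%:~R * t) =
    ((V * M) 1 0)%:~R + ((V * M) 1 1)%:~R * t.
  by rewrite -eM !mx22M /x; ring.
by rewrite e0 e1 /x /X /Y eV eU /det22 !mx22M; ring.
Qed.

Lemma affine_bounds (R : realFieldType) (x y t : R) :
  0 <= y <= x -> 0 <= t <= 1 -> x <= x + y * t <= 2 * x.
Proof.
move=> /andP[y0 yx] /andP[t0 t1].
have yt : y * t <= x * 1 by exact: ler_pM.
by rewrite lerDl mulr_ge0 //= mulr_natl mulr2n lerD2l -[leRHS]mulr1.
Qed.

Lemma affine_le (R : realFieldType) (x y x' y' t : R) :
  0 <= x' <= x -> 0 <= y' <= y -> 0 <= t -> 0 <= x' + y' * t <= x + y * t.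
Proof.
move=> /andP[x0 xx] /andP[y0 yy] t0.
by rewrite addr_ge0 ?mulr_ge0 //= lerD // ler_wpM2r.
Qed.

Lemma sandwich_divide (R : realFieldType) (C F x X m n : R) :
  1 <= m -> 1 <= n -> n * m <= x <= 4 * (n * m) -> m <= X <= 2 * m ->
  0 <= F -> 0 <= C -> X <= x ^+ 2 * F <= C * X ->
  1 <= 16 * m * n ^+ 2 * F /\ m * n ^+ 2 * F <= 2 * C.
Proof.
move=> m1 n1 /andP[x1 x2] /andP[X1 X2] F0 C0 /andP[h1 h2].
have m0 : 0 < m by lra.
have nm : 1 * 1 <= n * m by apply: ler_pM.
have xl : (n * m) ^+ 2 * F <= x ^+ 2 * F.
  by apply: ler_wpM2r => //; apply: lerXn2r; rewrite ?nnegrE //; lra.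
have xu : x ^+ 2 * F <= (4 * (n * m)) ^+ 2 * F.
  by apply: ler_wpM2r => //; apply: lerXn2r; rewrite ?nnegrE //; lra.
have CX : C * X <= C * (2 * m) by apply: ler_wpM2l.
split; rewrite -(ler_pM2l m0).
  rewrite mulr1 (_ : m * _ = (4 * (n * m)) ^+ 2 * F); last by ring.
  by lra.
rewrite (_ : m * (m * _ * _) = (n * m) ^+ 2 * F); last by ring.
by lra.
Qed.

Section instance.
Variables (R : realType) (a b : nat) (s : nat -> nat).
Hypotheses (ha : (0 < a)%N) (hb : (0 < b)%N).
Hypothesis (hs : forall k : nat, (0 < k)%N -> (0 < s k)%N).

Local Notation W := (sturmian_mx a b s).
Local Notation c := (sturmian_limit_word a b s).
Local Notation zeta := (sturmian_cf R a b s).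
Definition sturmian_norm k : R := (W k 0 0)%:~R.
Local Notation N := sturmian_norm.
Local Notation B := ((a + b).+1%:R : R).

Let wc k := sturmian_mx_cone ha hb hs k.

Lemma sturmian_limit_pos : pos_seq c.
Proof.
move=> i; have [h <-] := sturmian_limit_wordP a b hs (ltnSn i).
have : all (fun c => 0 < c)%N (sturmian_word a b s i.+1) by exact: sturmian_word_all.
by move=> /all_nthP; apply.
Qed.

Lemma sturmian_limit_le i : (c i < (a + b).+1)%N.
Proof.
have [h <-] := sturmian_limit_wordP a b hs (ltnSn i).
have : all (fun c => c < (a + b).+1)%N (sturmian_word a b s i.+1).
  by apply: sturmian_word_all; rewrite ltnS ?leq_addr ?leq_addl.
by move=> /all_nthP; apply.
Qed.

Lemma zeta_bounds : B^-1 <= zeta <= 1.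
Proof.
have pc := sturmian_limit_pos.
have pc' : pos_seq (tail_seq c) by move=> i; exact: pc.
have /andP[t0 t1] := cfrac_lim01 R pc'.
have h := cfrac_lim_shift R pc; rewrite /sturmian_cf h.
have c1 : 1 <= ((c 0)%:R : R) by rewrite ler1n pc.
have cB : (c 0)%:R + 1 <= B by rewrite natr1 ler_nat sturmian_limit_le.
apply/andP; split.
  by rewrite lef_pV2 ?posrE; lra.
by rewrite invf_le1; lra.
Qed.

Lemma sturmian_norm_ge1 k : 1 <= N k.
Proof. by have [[h _ _ _ _] _ _ _ _ _ _] := wc k; rewrite /N ler1z. Qed.

Lemma sturmian_pow_cone k n : cone_mx (W k.+1 ^+ n * W k).
Proof.
rewrite -word_mx_flatten -word_mx_cat; apply: word_cone.
by rewrite /pos_word all_cat all_flatten_nseq ?sturmian_word_all.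
Qed.

(** Upper left entries of products are multiplicative up to the factor 2. *)
Lemma sturmian_norm_step k :
  N k.+1 ^+ s k.+2 * N k <= N k.+2 <= 2 ^+ s k.+2 * (N k.+1 ^+ s k.+2 * N k).
Proof.
have [ck _ _ _ _ _ _] := wc k.+1.
suff : W k.+1 0 0 ^+ s k.+2 * W k 0 0 <= W k.+2 0 0 <=
    2 ^+ s k.+2 * (W k.+1 0 0 ^+ s k.+2 * W k 0 0).
  have e2 : (2 : R) ^+ s k.+2 = (2 ^+ s k.+2 : int)%:~R by rewrite rmorphXn.
  by rewrite /N e2 -!rmorphXn -!rmorphM !ler_int.
rewrite sturmian_mxSS; elim: (s k.+2) => [|n /andP[IH1 IH2]].
  by rewrite !expr0 !mul1r lexx.
have /andP[h1 h2] := cone_mul_00 ck (sturmian_pow_cone k n).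
have w0 : 0 <= W k.+1 0 0 by have := cone_00 ck; lia.
rewrite !exprS -!mulrA; apply/andP; split.
  by apply: le_trans h1; apply: ler_wpM2l.
apply: le_trans h2 _; rewrite ler_pM2l // mulrCA.
by apply: ler_wpM2l.
Qed.

Lemma sturmian_norm_incr k : N k.+1 + 1 <= N k.+2.
Proof.
suff : W k.+1 0 0 + 1 <= W k.+2 0 0 by rewrite /N -(ler_int R) rmorphD.
have := sturmian_mxSS a b s k; have : (0 < s k.+2)%N by exact: hs.
case: (s k.+2) => // n _ ->; rewrite exprS -mulrA mx22M.
have [x0 _ x2 _ _] := sturmian_pow_cone k n.
have [[w0 w1 _ _ _] w01 _ _ _ _ _] := wc k.+1.
have x10 : 1 <= (W k.+1 ^+ n * W k) 1 0.
  rewrite -word_mx_flatten -word_mx_cat.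
  apply: (open_10 (B := (a + b).+1)); apply: word_open_cone.
  - by rewrite /pos_word all_cat all_flatten_nseq ?sturmian_word_all.
  - case: (sturmian_word_size a b hs k) => h _.
    by rewrite -size_eq0 size_cat addn_eq0 negb_and orbC -lt0n h.
  - have aB : (a < (a + b).+1)%N by rewrite ltnS leq_addr.
    have bB : (b < (a + b).+1)%N by rewrite ltnS leq_addl.
    by rewrite all_cat all_flatten_nseq ?sturmian_word_all.
have h1 : W k.+1 0 0 * 1 <= W k.+1 0 0 * (W k.+1 ^+ n * W k) 0 0 by apply: ler_wpM2l x0; exact: le_trans w0.
have h2 : 1 * 1 <= W k.+1 0 1 * (W k.+1 ^+ n * W k) 1 0 by apply: ler_pM.
by rewrite mulr1 in h1 h2; exact: lerD.
Qed.

Lemma sturmian_norm_ge k : k.+1%:R <= N k.+1.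
Proof.
elim: k => [|k IH]; first exact: sturmian_norm_ge1.
by apply: le_trans (sturmian_norm_incr k); rewrite -natr1 lerD2r.
Qed.

Hypothesis hab : a <> b.

(** The word m_(k+2) m_(k+1) is a prefix of the limit word, so the vector (1, zeta) is
proportional to W_(k+2) W_(k+1) (1, t); [fixed_poly_wedge] then compares the
exchanged products. *)
Lemma sturmian_value k :
  1 <= 16 * N k.+1 * N k.+2 ^+ 2 * `|(toR R (fixed_poly (W k.+1))).[zeta]| /\
  N k.+1 * N k.+2 ^+ 2 * `|(toR R (fixed_poly (W k.+1))).[zeta]| <= 2 * B ^+ 3.
Proof.
have [r er] := sturmian_word_next a b hs k.
have eu := sturmian_word_mkseq hs er.
have [t t01 zt] := cfrac_direction R (size (sturmian_word a b s k.+2 ++ sturmian_word a b s k.+1)) sturmian_limit_pos.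
move: zt; rewrite -eu word_mx_cat -!/(W _) -/zeta.
set M := W k.+1; set W2 := W k.+2; set U := W2 * M => zt.
have [P [dP PA]] := sturmian_mx_swap a b s k.+1.
have eM : M * U = (M * W2) * M by rewrite /U mulrA.
have FW := fun A A' h h' => @fixed_poly_wedge R M U (M * W2) P A A' zeta t h h' eM zt.
set F := (toR R (fixed_poly M)).[zeta] in FW *.
set x := (U 0 0)%:~R + (U 0 1)%:~R * t in FW zt.
set X := (M 0 0)%:~R + (M 0 1)%:~R * t in FW.
set Y := (M 1 0)%:~R + (M 1 1)%:~R * t in FW.
have /andP[t0 t1] := t01.
have [[m0 m1 m2 m3 m4] m5 m6 m7 m8 m9 m10] := wc k.+1.
have castle (i j : int) : i <= j -> (i%:~R : R) <= j%:~R by rewrite ler_int.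
have castle2 (i j : int) : 0 <= i <= j -> (0 : R) <= i%:~R <= j%:~R.
  by rewrite ler0z ler_int.
have XY : 0 <= Y <= X.
  apply: affine_le => //; first exact: castle2.
  by apply: castle2; rewrite m8 andbT; case/andP: m3.
have NX : N k.+1 <= X <= 2 * N k.+1 by apply: affine_bounds => //; exact: castle2.
have cU : cone_mx U.
  rewrite /U /W2 /M /sturmian_mx -word_mx_cat; apply: word_cone.
  by rewrite /pos_word all_cat !sturmian_word_all.
have NU : N k.+2 * N k.+1 <= x <= 4 * (N k.+2 * N k.+1).
  have /andP[u1 u2] : (U 0 0)%:~R <= x <= 2 * (U 0 0)%:~R.
    by apply: affine_bounds => //; apply: castle2; case: cU.
  have /andP[w1 w2] := cone_mul_00 (open_cone_cone (wc k.+2)) (open_cone_cone (wc k.+1)).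
  rewrite -/M -/W2 -/U in w1 w2.
  have c3 : N k.+2 * N k.+1 <= (U 0 0)%:~R by rewrite -rmorphM; exact: castle.
  have c4 : (U 0 0)%:~R <= 2 * (N k.+2 * N k.+1).
    by rewrite -rmorphM -(rmorphM intr 2%:Z); exact: castle.
  rewrite (le_trans c3 u1) (le_trans u2) // (_ : 4 * _ = 2 * (2 * (N k.+2 * N k.+1))).
    by rewrite ler_pM2l.
  by ring.
have [h1 h2] : X <= x ^+ 2 * `|F| /\ x ^+ 2 * `|F| <= B ^+ 3 * X.
  have -> : x ^+ 2 * `|F| = `|x ^+ 2 * F| by rewrite normrM ger0_norm // sqr_ge0.
  have dP' : `|(det22 P)%:~R| = 1 :> R by rewrite -intr_norm dP.
  have wle p q e := letter_wedge_le p q e t01 XY.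
  have LW (p q : nat) : (((p%:Z * q%:Z + 1 * 1)%:~R + (p%:Z * 1 + 1 * 0)%:~R * t) *
      ((1 * p%:Z + 0 * 1)%:~R * X + (1 * 1 + 0 * 0)%:~R * Y) -
      ((1 * q%:Z + 0 * 1)%:~R + (1 * 1 + 0 * 0)%:~R * t) *
      ((q%:Z * p%:Z + 1 * 1)%:~R * X + (q%:Z * 1 + 1 * 0)%:~R * Y))
      = letter_wedge p%:R q%:R t X Y by rewrite /letter_wedge; ring.
  case: PA => -[h h']; rewrite (FW _ _ h h') normrM dP' mul1r !mx22M !mxE /= LW.
    by have /andP[] := wle _ _ ha hb hab.
  by have /andP[] := wle _ _ hb ha (not_eq_sym hab); rewrite addnC.
apply: (sandwich_divide _ _ NU NX) => //; rewrite ?sturmian_norm_ge1 //.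
by rewrite h1.
Qed.

End instance.

(** * Sturmian continued fractions have the approximation data *)

(** The quotient m / y would be an integer r with r^2 = T^2 - 4 or T^2 + 4, too
close to T^2 to be a square. *)
Lemma sqr_sub4_not_sqr (m y T d : int) :
  y != 0 -> 3 <= T -> `|d| = 1 -> m ^+ 2 != y ^+ 2 * (T ^+ 2 - 4 * d).
Proof.
move=> y0 T3 d1; apply/eqP => E.
have ym : (y %| m)%Z.
  rewrite -(@dvdz_pexp2r _ _ 2) //; apply/dvdzP.
  by exists (T ^+ 2 - 4 * d); rewrite E mulrC.
have /dvdzP[r er] := ym.
have rE : r ^+ 2 = T ^+ 2 - 4 * d.
  apply: (mulfI (expf_neq0 2 y0)); rewrite -E er; ring.
have : (`|r| : int) ^+ 2 = T ^+ 2 - 4 * d by rewrite real_normK ?num_real.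
have : 0 <= (`|r| : int) by [].
move: (`|r| : int) => {rE er}r r0 rE.
have : d = 1 \/ d = -1 by lia.
have [rT|rT] := lerP T r.
  have [rT'|rT'] := lerP (T + 1) r; case=> de; move: rE; rewrite de !expr2; nia.
by case=> de; move: rE; rewrite de !expr2; nia.
Qed.

(** The second root of the fixed point polynomial is nonpositive, so its distance
from z is at least z. *)
Lemma fixed_poly_root (R : realType) (A : 'M[int]_2) (z : R) :
  1 <= A 0 1 -> 0 <= A 1 0 -> A 1 1 <= A 0 0 -> 0 <= z ->
  exists2 alpha : R, root (toR R (fixed_poly A)) alpha &
    (A 0 1)%:~R * z * `|alpha - z| <= `|(toR R (fixed_poly A)).[z]|.
Proof.
move=> h01 h10 h11 z0.
pose m : R := (A 0 1)%:~R; pose e : R := (A 0 0)%:~R - (A 1 1)%:~R; pose n : R := (A 1 0)%:~R.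
have m1 : 1 <= m by rewrite ler1z.
have e0 : 0 <= e by rewrite subr_ge0 ler_int.
have n0 : 0 <= n by rewrite ler0z.
pose delta := Num.sqrt (e ^+ 2 + 4 * m * n).
have D0 : 0 <= e ^+ 2 + 4 * m * n.
  by rewrite addr_ge0 ?sqr_ge0 // mulr_ge0 // mulr_ge0 //; lra.
have dE : delta ^+ 2 = e ^+ 2 + 4 * m * n by rewrite sqr_sqrtr.
have d0 : 0 <= delta by exact: sqrtr_ge0.
have m0 : m != 0 by rewrite gt_eqF //; lra.
pose alpha := (delta - e) / (2 * m); pose beta := (- delta - e) / (2 * m).
have F x : (toR R (fixed_poly A)).[x] = - m * (x - alpha) * (x - beta).
  rewrite horner_fixed_poly -/n -/m (_ : (A 1 1)%:~R - (A 0 0)%:~R = - e); last by rewrite /e; ring.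
  rewrite (_ : n = (delta ^+ 2 - e ^+ 2) / (4 * m)); last by rewrite dE; field.
  by rewrite /alpha /beta; field.
exists alpha; first by rewrite rootE F subrr mulr0 mul0r.
have b0 : beta <= 0.
  rewrite /beta -oppr_ge0 -mulNr divr_ge0 //; lra.
rewrite F !normrM normrN (ger0_norm (le_trans ler01 m1)) [`|z - alpha|]distrC.
rewrite -!mulrA [z * _]mulrC; apply: ler_wpM2l; first lra.
apply: ler_wpM2l; first exact: normr_ge0.
rewrite ger0_norm; lra.
Qed.

(** The discriminant is the squared trace minus four times the determinant. *)
Lemma fixed_poly_irrational (R : realType) (A : 'M[int]_2) (alpha : R) (P : {poly int}) :
  `|det22 A| = 1 -> 3 <= A 0 0 + A 1 1 -> root (toR R (fixed_poly A)) alpha ->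
  P != 0 -> root (toR R P) alpha -> (2 < size P)%N.
Proof.
move=> dA tA /rootP rA P0 /rootP rP; rewrite ltnNge; apply/negP => sP.
have P2 i : (2 <= i)%N -> P`_i = 0 by exact: coef_ge_size.
have PE : (P`_0)%:~R + (P`_1)%:~R * alpha = 0.
  by rewrite -rP horner3 ?size_toR ?(leq_trans sP) // !coef_map /= (P2 2%N) // mulr0z mul0r addr0.
have p1 : P`_1 != 0.
  apply/eqP => p1; move: PE; rewrite p1 mul0r addr0 => /eqP; rewrite intr_eq0 => /eqP p0.
  by move/eqP: P0; apply; apply/polyP => -[|[|i]]; rewrite ?coef0 // P2.
have E : A 1 0 * P`_1 ^+ 2 - (A 1 1 - A 0 0) * P`_0 * P`_1 - A 0 1 * P`_0 ^+ 2 = 0.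
  apply/eqP; rewrite -(intr_eq0 R); apply/eqP.
  have aE : (P`_0)%:~R = - (P`_1)%:~R * alpha by lra.
  transitivity ((P`_1)%:~R ^+ 2 * (toR R (fixed_poly A)).[alpha]); last by rewrite rA mulr0.
  rewrite horner_fixed_poly !expr2 !rmorphB !rmorphM /= aE; ring.
have /eqP := sqr_sub4_not_sqr (2 * A 0 1 * P`_0 + (A 1 1 - A 0 0) * P`_1) p1 tA dA.
apply; apply/eqP; rewrite -subr_eq0; apply/eqP.
rewrite [LHS](_ : _ = - 4 * A 0 1 * (A 1 0 * P`_1 ^+ 2
  - (A 1 1 - A 0 0) * P`_0 * P`_1 - A 0 1 * P`_0 ^+ 2)); first by rewrite E mulr0.
by rewrite /det22; ring.
Qed.

Lemma coef_fixed_poly_le (A : 'M[int]_2) i :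
  cone_mx A -> `|(fixed_poly A)`_i| <= A 0 0.
Proof.
move=> [a0 a1 a2 a3 _].
case: i => [|[|[|i]]]; rewrite coef_Poly ?[nth _ _ _]/=; try lia.
by rewrite nth_default // normr0; lia.
Qed.

Lemma distn_le_succ_add (a b : nat) : `|a%:Z - b%:Z| <= (a + b).+1%:Z.
Proof. lia. Qed.

Section instance.
Variables (R : realType) (a b : nat) (s : nat -> nat).
Hypotheses (ha : (0 < a)%N) (hb : (0 < b)%N) (hab : a <> b).
Hypothesis (hs : forall k : nat, (0 < k)%N -> (0 < s k)%N).

Local Notation W := (sturmian_mx a b s).
Local Notation zeta := (sturmian_cf R a b s).
Local Notation N := (sturmian_norm R a b s).
Local Notation B := ((a + b).+1%:R : R).
Let L k := ln (N k.+3).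
(* Dominates every constant below: 16 and 2 * B ^+ 3 for the values, 4 * B ^+ 2 and
   B for linear forms, 2 * B ^+ 5 for the roots. *)
Let kap := 16 * B ^+ 5.

(** The indices are shifted by 3: then N_k >= 3, so that the logarithms are
positive and the traces large enough for [sqr_sub4_not_sqr], and the prefix
property behind [sturmian_value] holds. *)
Lemma sturmian_approximations :
  quadratic_approximations zeta kap L (fun k => fixed_poly (W k.+3)).
Proof.
have B3 : 3 <= B by rewrite ler_nat ltnS (leq_add ha hb).
have Bpow i j : (i <= j)%N -> B ^+ i <= B ^+ j.
  by move=> ij; rewrite ler_weXn2l //; lra.
have B5 : 1 <= B ^+ 5 by rewrite exprn_ege1 //; lra.
have k0 : 0 <= kap by rewrite /kap; lra.
have ek C : C <= kap -> C <= expR kap by have := expR_ge1Dx kap; lra.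
have ekN C : 0 < C -> C <= kap -> expR (- kap) * C <= 1.
  move=> C0 /ek Ck; rewrite -(ler_pM2l (expR_gt0 kap)) mulrA -expRD subrr expR0.
  by rewrite mul1r mulr1.
have N0 k : 0 < N k by exact: lt_le_trans ltr01 (sturmian_norm_ge1 R ha hb hs k).
have LN k : expR (L k) = N k.+3 by rewrite lnK ?posrE.
have wc k := sturmian_mx_cone ha hb hs k.
have /andP[zB z1] := zeta_bounds R ha hb hs.
have B0 : 0 < B by lra.
have z0 : 0 <= zeta by apply: le_trans zB; rewrite invr_ge0; lra.
have LL k x : expR (x - L k - 2 * L k.+1) * (N k.+3 * N k.+4 ^+ 2) = expR x.
  rewrite -!LN expr2 -!expRD; congr expR; ring.
have NN k : 0 < N k.+3 * N k.+4 ^+ 2 by rewrite mulr_gt0 // exprn_gt0.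
have val_le k : `|(toR R (fixed_poly (W k.+3))).[zeta]| <= 2 * B ^+ 3 * expR (- L k - 2 * L k.+1).
  have [_ h] := sturmian_value R ha hb hs hab k.+2.
  rewrite -(ler_pM2r (NN k)) mulrC; apply: le_trans h _.
  by have := LL k 0; rewrite expR0 sub0r => e0; rewrite -[leRHS]mulrA e0 mulr1.
have Bk (x : R) i : x <= 16 -> 0 <= x -> (i <= 5)%N -> x * B ^+ i <= kap.
  by move=> x16 x0 i5; apply: ler_pM => //; exact: Bpow.
have k1 : 1 <= kap by rewrite /kap; lra.
have kB : B <= kap.
  by have := Bk 1 1%N; rewrite expr1 mul1r; apply=> //; lra.
split.
- exact: k0.
- by rewrite z0.
- by apply: ln_ge0; exact: sturmian_norm_ge1.
- move=> k; rewrite ler_ln ?posrE //.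
  by have := sturmian_norm_incr R ha hb hs k.+2; lra.
- move=> x; exists (Num.bound (expR x)).
  rewrite -ler_expR LN; apply: le_trans (sturmian_norm_ge R ha hb hs _).
  apply: le_trans (ltW (archi_boundP (expR_ge0 x))) _.
  by rewrite ler_nat; do 3! apply: leqW.
- by move=> k; exact: size_fixed_poly.
- move=> k i; rewrite expRD LN.
  have : `|((fixed_poly (W k.+3))`_i)%:~R : R| <= N k.+3.
    by rewrite -intr_norm ler_int coef_fixed_poly_le //; case: (wc k.+3).
  move=> h; apply: le_trans h _; rewrite ler_peMl //; first exact: ltW.
  exact: ek.
- move=> k; rewrite coef_fixed_poly.
  have [[a0 a1 a2 a3 a4] h1 h2 h3 h4 h5 h6] := wc k.+3.
  rewrite addrC expRD LN -(ler_pM2l (expR_gt0 kap)) mulrA -expRD subrr expR0 mul1r.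
  rewrite ger0_norm ?ler0z; last exact: le_trans h2.
  have h : N k.+3 <= B * (W k.+3 1 0)%:~R by rewrite /sturmian_norm -(rmorphM intr (a + b).+1%:Z) ler_int.
  apply: le_trans h _; apply: ler_wpM2r; first by rewrite ler0z (le_trans _ h2).
  exact: ek.
- move=> k; rewrite coef_fixed_poly rmorphN normrN.
  have [[a0 a1 a2 a3 a4] h1 h2 h3 h4 h5 h6] := wc k.+3.
  rewrite addrC expRD LN -(ler_pM2l (expR_gt0 kap)) mulrA -expRD subrr expR0 mul1r.
  rewrite ger0_norm ?ler0z; last exact: le_trans h1.
  have h : N k.+3 <= B * (W k.+3 0 1)%:~R by rewrite /sturmian_norm -(rmorphM intr (a + b).+1%:Z) ler_int.
  apply: le_trans h _; apply: ler_wpM2r; first by rewrite ler0z (le_trans _ h1).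
  exact: ek.
- move=> k; apply: le_trans (val_le k) _.
  rewrite (_ : kap - L k - 2 * L k.+1 = kap + (- L k - 2 * L k.+1)); last by ring.
  rewrite [expR (kap + _)]expRD; apply: ler_wpM2r; first exact: expR_ge0.
  by apply: ek; apply: Bk => //; lra.
- move=> k; rewrite -(ler_pM2r (NN k)) LL.
  have [h _] := sturmian_value R ha hb hs hab k.+2.
  have h16 : expR (- kap) * 16 <= 1.
    by apply: ekN => //; have := Bk 16 0; rewrite expr0 mulr1; apply.
  by rewrite mulrC; lra.
- move=> k; rewrite -normr_gt0 sturmian_res // exprn_even_gt0 //= subr_eq0.
  by apply/eqP => -[].
- move=> k; rewrite -intr_norm sturmian_res //; apply: ek.
  have := Bk 1 2; rewrite mul1r => h; apply: le_trans (h _ _ _) => //; [|lra].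
  rewrite -real_normK ?num_real // rmorphXn /=; apply: lerXn2r; rewrite ?nnegrE //.
  by rewrite -[B]/((a + b).+1%:Z%:~R) ler_int distn_le_succ_add.
- move=> u v x uv ux vx.
  have h := badly_approximable (sturmian_limit_pos ha hb hs) (sturmian_limit_le a b hs) uv ux vx.
  rewrite -/(sturmian_cf R a b s) in h.
  rewrite expRD expRN -(ler_pM2r (expR_gt0 x)) -mulrA -expRD addNr expR0 mulr1.
  rewrite -(ler_pM2l (expR_gt0 kap)) mulfV ?gt_eqF ?expR_gt0 //.
  apply: le_trans h _.
  rewrite [leRHS](_ : _ = expR kap * (expR x * `|u%:~R * zeta + v%:~R|)); last by ring.
  rewrite -mulrA; apply: ler_wpM2r; first by rewrite mulr_ge0 // expR_ge0.
  by apply: ek; apply: Bk => //; lra.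
- move=> x x0; have x1 : 1 <= expR x by rewrite -[leLHS]expR0 ler_expR.
  have [u [v [uv ux vx h]]] := linear_approximation (sturmian_limit_pos ha hb hs) (sturmian_limit_le a b hs) x1.
  exists u, v; split=> //; apply: le_trans h _.
  rewrite expRD expRN; apply: ler_wpM2r; first by rewrite invr_ge0 expR_ge0.
  exact: ek.
- move=> k.
  have [[a0 a1 a2 a3 a4] h1 h2 h3 h4 h5 h6] := wc k.+3.
  have /andP[a30 a31] := a3.
  have [alpha ra az] := fixed_poly_root h1 (le_trans ler01 h2) a31 z0.
  exists alpha; split=> //; last first.
    move=> P P0 rP; apply: fixed_poly_irrational ra P0 rP; first exact: det22_word.
    have : 3%:Z <= W k.+3 0 0.
      rewrite -(ler_int R); apply: le_trans (sturmian_norm_ge R ha hb hs k.+2).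
      by rewrite -[3%:Z%:~R]/(3%:R) ler_nat.
    by move=> h3'; rewrite -[3]addr0; exact: lerD.
  have h : N k.+3 <= B * (W k.+3 0 1)%:~R by rewrite /sturmian_norm -(rmorphM intr (a + b).+1%:Z) ler_int.
  have w1 : 1 <= ((W k.+3 0 1)%:~R : R) by rewrite ler1z.
  have zB1 : 1 <= B * zeta by rewrite -ler_pdivrMl // mulr1.
  have Nz : N k.+3 <= B ^+ 2 * ((W k.+3 0 1)%:~R * zeta).
    have := ler_pM (ltW (N0 k.+3)) ler01 h zB1; rewrite mulr1 => /le_trans; apply.
    by rewrite le_eqVlt; apply/orP; left; apply/eqP; ring.
  have e1 : N k.+3 * `|alpha - zeta| <= B ^+ 2 * (2 * B ^+ 3 * expR (- L k - 2 * L k.+1)).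
    apply: le_trans (ler_wpM2r (normr_ge0 (alpha - zeta)) Nz) _.
    rewrite -[leLHS]mulrA; apply: ler_wpM2l; first by rewrite exprn_ge0.
    exact: le_trans az (val_le k).
  rewrite -(ler_pM2l (N0 k.+3)); apply: le_trans e1 _.
  rewrite -LN -expRD (_ : L k + _ = kap + (- L k - 2 * L k.+1)); last by ring.
  rewrite [expR (kap + _)]expRD mulrA; apply: ler_wpM2r; first exact: expR_ge0.
  apply: ek; rewrite (_ : _ * _ = 2 * B ^+ 5); last by ring.
  by apply: Bk => //; lra.
Qed.

End instance.

(** * Ratios of consecutive norms *)

Section liminf.
Local Open Scope classical_set_scope.
Local Open Scope ring_scope.
Variables (R : realType) (u : nat -> R).
Hypothesis u01 : forall k, 0 <= u k <= 1.

Let ub : bounded_fun u.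
Proof.
exists 1; split; first exact: num_real.
move=> x x1 k _ /=; case/andP: (u01 k) => h0 h1.
by rewrite ger0_norm //; lra.
Qed.

Lemma limn_inf_lt_eventually theta : theta < limn_inf u ->
  exists K, forall k, (K <= k)%N -> theta < u k.
Proof.
rewrite limn_infE // => /sup_gt h.
have [|_ [K _ <-] hK] := h; first by exists (infs u 0); exists 0%N.
exists K => k Kk; apply: lt_le_trans hK _.
apply: ge_inf; last by exists k.
by apply: has_lbound_sdrop; exact: bounded_fun_has_lbound.
Qed.

Lemma limn_inf_gt_often theta K : limn_inf u < theta ->
  exists2 k, (K <= k)%N & u k < theta.
Proof.
rewrite limn_infE // => h.
have : infs u K < theta.
  apply: le_lt_trans h; apply: ub_le_sup; last by exists K.
  exact: bounded_fun_has_ubound_infs.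
move=> /inf_lt h'; have [|_ [k Kk <-] hk] := h'; first by exists (u K); exists K => /=.
by exists k.
Qed.

Lemma limn_inf01 : 0 <= limn_inf u <= 1.
Proof.
apply/andP; split; rewrite leNgt; apply/negP => h.
  have [k _ hk] := limn_inf_gt_often 0 h.
  by have := u01 k; lra.
have [K hK] := limn_inf_lt_eventually h.
by have := hK K (leqnn K); have := u01 K; lra.
Qed.

End liminf.

Section perturbed.
Local Open Scope classical_set_scope.
Local Open Scope ring_scope.
Variables (R : realType) (y u S : nat -> R) (delta : nat -> R).
Hypothesis S1 : forall k, 1 <= S k.
Hypothesis y01 : forall k, 0 <= y k <= 1.
Hypothesis u01 : forall k, 0 <= u k <= 1.
Hypothesis d0 : forall k, 0 <= delta k.
Hypothesis yE : forall k, y k.+1 = (S k * (1 + delta k) + y k)^-1.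
Hypothesis uE : forall k, u k.+1 = (S k + u k)^-1.
Hypothesis dlim : forall e, 0 < e -> exists K, forall k, (K <= k)%N -> delta k <= e.

Lemma perturbed_step k :
  `|y k.+1 - u k.+1| <= u k.+1 * `|y k - u k| + delta k.
Proof.
have [/andP[y0 y1] /andP[u0 u1]] := (y01 k, u01 k).
have s1 := S1 k; have dk := d0 k.
have sd : 0 <= S k * delta k by apply: mulr_ge0; lra.
have Dy : 0 < S k * (1 + delta k) + y k by lra.
have Du : 0 < S k + u k by lra.
have e : y k.+1 - u k.+1 = (u k - y k - S k * delta k) * (y k.+1 * u k.+1).
  by rewrite yE uE; field; rewrite !gt_eqF.
have yp := y01 k.+1; have up := u01 k.+1.
case/andP: yp => yp0 yp1; case/andP: up => up0 up1.
rewrite e normrM (ger0_norm (mulr_ge0 yp0 up0)).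
have h1 : `|u k - y k - S k * delta k| <= `|y k - u k| + S k * delta k.
  by apply: le_trans (ler_normB _ _) _; rewrite distrC (ger0_norm sd).
have h2 := ler_wpM2r (mulr_ge0 yp0 up0) h1.
have h3 : u k.+1 * S k <= 1.
  by rewrite uE mulrC ler_pdivrMr // mul1r; lra.
have h4 : `|y k - u k| * (y k.+1 * u k.+1) <= u k.+1 * `|y k - u k|.
  rewrite mulrA mulrC; apply: ler_wpM2l => //.
  by rewrite ler_piMr.
have h5 : S k * delta k * (y k.+1 * u k.+1) <= delta k.
  rewrite (_ : _ * _ = delta k * (y k.+1 * (u k.+1 * S k))); last by ring.
  rewrite ler_piMr // -[leRHS]mulr1 ler_pM // mulr_ge0 //; lra.
lra.
Qed.

(** The map x |-> 1 / (S + x) need not contract, but two of its steps halve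
distances, because u (k+2) * u (k+1) <= 1/2; small perturbations thus stay small
in the long run. *)
Lemma perturbed_close e : 0 < e ->
  exists K, forall k, (K <= k)%N -> `|y k - u k| <= e.
Proof.
move=> e0; have [|K0 hK0] := dlim (e := e / 8); first lra.
have two k : (K0 <= k)%N -> `|y k.+2 - u k.+2| <= `|y k - u k| / 2 + e / 4.
  move=> K0k; have h1 := perturbed_step k; have h2 := perturbed_step k.+1.
  have d1 := hK0 k K0k; have d2 := hK0 k.+1 (leqW K0k).
  have [/andP[a0 a1] /andP[b0 b1]] := (u01 k.+1, u01 k.+2).
  have h3 := ler_wpM2l b0 h1.
  have h4 : u k.+2 * u k.+1 <= 1 / 2.
    have s1 := S1 k.+1.
    by rewrite uE mulrC ler_pdivrMr; lra.
  have h5 := ler_wpM2r (normr_ge0 (y k - u k)) h4.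
  have h6 : u k.+2 * delta k <= delta k by rewrite ler_piMl.
  lra.
have iter j m : (K0 <= m)%N -> `|y (j.*2 + m) - u (j.*2 + m)| <= 2^-1 ^+ j + e / 2.
  move=> K0m; elim: j => [|j IH].
    rewrite expr0 add0n; have [/andP[a0 a1] /andP[b0 b1]] := (y01 m, u01 m).
    by rewrite ler_norml; apply/andP; split; lra.
  have := two (j.*2 + m)%N; rewrite doubleS !addSn exprS => /(_ (leq_trans K0m (leq_addl _ _))).
  lra.
have [J hJ] : exists J, (2^-1 : R) ^+ J < e / 2.
  have : (fun n => (2^-1 : R) ^+ n) @ \oo --> (0 : R).
    by apply: cvg_expr; rewrite ger0_norm ?invr_ge0 // invf_lt1 // ltr1n.
  move=> /cvgr0Pnorm_lt /(_ (e / 2)) h; have [|N _ hN] := h; first lra.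
  by exists N; have := hN N (leqnn N) => /=; rewrite ger0_norm // exprn_ge0 // invr_ge0.
exists (J.*2 + K0)%N => k Kk.
have := iter J (k - J.*2)%N; rewrite subnKC ?(leq_trans (leq_addr _ _) Kk) //.
by rewrite leq_subRL ?(leq_trans (leq_addr _ _) Kk) // => /(_ Kk); lra.
Qed.

End perturbed.

Section ratios.
Variables (R : realType) (a b : nat) (s : nat -> nat).
Hypotheses (ha : (0 < a)%N) (hb : (0 < b)%N).
Hypothesis (hs : forall k : nat, (0 < k)%N -> (0 < s k)%N).

Local Notation N := (sturmian_norm R a b s).
Let L k := ln (N k.+3).
Let u k := cfrac R (rev [seq s i | i <- iota 1 k]).

Let uS k : u k.+1 = ((s k.+1)%:R + u k)^-1.
Proof.
have E : iota 1 k.+1 = iota 1 k ++ [:: k.+1] by rewrite -(addn1 k) iotaD add1n addn1.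
by rewrite /u E map_cat rev_cat.
Qed.

Let u01 k : 0 <= u k <= 1.
Proof.
apply: cfrac01; rewrite all_rev all_map; apply/allP => i /=.
by rewrite mem_iota => /andP[i1 _]; exact: hs.
Qed.

Let L_gt0 k : 0 < L k.
Proof.
apply: ln_gt0; apply: lt_le_trans (sturmian_norm_ge R ha hb hs _).
by rewrite ltr1n.
Qed.

Let L_mono k : L k <= L k.+1.
Proof.
have N0 j : 0 < N j by exact: lt_le_trans ltr01 (sturmian_norm_ge1 R ha hb hs j).
by rewrite ler_ln ?posrE //; have := sturmian_norm_incr R ha hb hs k.+2; lra.
Qed.

Let L_unbounded x : exists K, forall k, (K <= k)%N -> x <= L k.
Proof.
have N0 j : 0 < N j by exact: lt_le_trans ltr01 (sturmian_norm_ge1 R ha hb hs j).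
exists (Num.bound (expR x)) => k Kk; rewrite -ler_expR lnK ?posrE //.
apply: le_trans (sturmian_norm_ge R ha hb hs _).
apply: le_trans (ltW (archi_boundP (expR_ge0 x))) _.
by rewrite ler_nat; lia.
Qed.

Let L_step k : exists2 e, 0 <= e <= (s k.+4)%:R &
  L k.+1 = (s k.+4)%:R * L k + ln (N k.+2) + e.
Proof.
have N0 j : 0 < N j by exact: lt_le_trans ltr01 (sturmian_norm_ge1 R ha hb hs j).
have /andP[h1 h2] := sturmian_norm_step R ha hb hs k.+2.
have X0 : 0 < N k.+3 ^+ s k.+4 * N k.+2 by rewrite mulr_gt0 // exprn_gt0.
have XE : ln (N k.+3 ^+ s k.+4 * N k.+2) = (s k.+4)%:R * L k + ln (N k.+2).
  by rewrite lnM ?posrE ?exprn_gt0 // lnXn // mulr_natl.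
exists (L k.+1 - ((s k.+4)%:R * L k + ln (N k.+2))); last by ring.
rewrite -XE subr_ge0 ler_ln ?posrE // h1 /= lerBlDr.
have : L k.+1 <= ln (2 ^+ s k.+4 * (N k.+3 ^+ s k.+4 * N k.+2)).
  by rewrite ler_ln ?posrE // mulr_gt0 // exprn_gt0.
rewrite lnM ?posrE ?exprn_gt0 // lnXn // => /le_trans; apply.
rewrite lerD2r -[ln 2 *+ _]mulr_natl ler_piMr //.
by have := le_ln1Dx (x := 1 : R); lra.
Qed.

Let y k := L k / L k.+1.

Let ratio_close e : 0 < e -> exists K, forall k, (K <= k)%N -> `|y k - u k.+4| <= e.
Proof.
have y01 k : 0 <= y k <= 1.
  by rewrite divr_ge0 ?(ltW (L_gt0 _)) //= ler_pdivrMr ?L_gt0 // mul1r.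
pose S k : R := (s k.+1.+4)%:R.
pose delta k := (L k.+2 - S k * L k.+1 - L k) / (S k * L k.+1).
have S1 k : 1 <= S k by rewrite ler1n hs.
have st k : 0 <= L k.+2 - S k * L k.+1 - L k <= S k.
  by have [e1 h E] := L_step k.+1; move: E h; rewrite -/(S k) -/(L k) => -> h; lra.
have SL k : 0 < S k * L k.+1 by rewrite mulr_gt0 // (lt_le_trans ltr01).
apply: (@perturbed_close R y (fun k => u k.+4) S delta) => //.
- by move=> k; rewrite /delta divr_ge0 ?(ltW (SL _)) //; case/andP: (st k).
- move=> k; have l1 := L_gt0 k.+1; have l2 := L_gt0 k.+2.
  have Sn : S k != 0 by rewrite gt_eqF // (lt_le_trans ltr01).
  have -> : S k * (1 + delta k) + y k = L k.+2 / L k.+1.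
    by rewrite /delta /y; field; rewrite Sn gt_eqF.
  by rewrite invf_div.
- move=> e' e0; have [K hK] := L_unbounded (e'^-1).
  exists K => k Kk; have hk := hK k.+1 (leqW Kk).
  rewrite /delta ler_pdivrMr //; case/andP: (st k) => _ /le_trans; apply.
  rewrite mulrCA ler_peMr ?(le_trans ler01) //.
  by rewrite -ler_pdivrMl // mulr1.
Qed.

Lemma sturmian_sigma01 : 0 <= sturmian_sigma R s <= 1.
Proof. exact: limn_inf01. Qed.

Lemma sturmian_ratio_ge theta C : theta < sturmian_sigma R s ->
  exists k0, forall k, (k0 <= k)%N -> C + theta * L k.+1 <= L k.
Proof.
move=> ts; pose mu := (sturmian_sigma R s - theta) / 3.
have mu0 : 0 < mu by rewrite divr_gt0 // subr_gt0.
have muE : 3 * mu = sturmian_sigma R s - theta by rewrite /mu; field.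
have sm : sturmian_sigma R s - mu < limn_inf u by rewrite -/(sturmian_sigma R s); lra.
have [K1 h1] := limn_inf_lt_eventually u01 sm.
have [K2 h2] := ratio_close mu0.
have [K3 h3] := L_unbounded (C / mu).
exists (maxn K1 (maxn K2 K3)) => k; rewrite !geq_max => /and3P[k1 k2 k3].
have a1 := h1 k.+4 (leq_trans k1 (leq_addl 4 k)).
have a2 := h2 k k2; have a3 := h3 k.+1 (leqW k3).
have l0 := L_gt0 k.+1.
have yl : theta + mu <= y k.
  by move: a2; rewrite ler_norml => /andP[? ?]; lra.
have := ler_wpM2r (ltW l0) yl; rewrite /y divfK ?gt_eqF // => h.
have : C <= mu * L k.+1 by rewrite mulrC -ler_pdivrMr.
lra.
Qed.

Lemma sturmian_ratio_le theta C k0 : sturmian_sigma R s < theta ->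
  exists2 k, (k0 <= k)%N & C + L k <= theta * L k.+1.
Proof.
move=> ts; pose mu := (theta - sturmian_sigma R s) / 3.
have mu0 : 0 < mu by rewrite divr_gt0 // subr_gt0.
have muE : 3 * mu = theta - sturmian_sigma R s by rewrite /mu; field.
have [K2 h2] := ratio_close mu0.
have [K3 h3] := L_unbounded (C / mu).
pose K := maxn k0 (maxn K2 K3).
have sm : limn_inf u < sturmian_sigma R s + mu by rewrite -/(sturmian_sigma R s); lra.
have [j Kj a1] := limn_inf_gt_often u01 K.+4 sm.
case: j Kj a1 => [|[|[|[|k]]]] // Kk a1.
have : (K <= k)%N by [].
rewrite /K !geq_max => /and3P[k1 k2 k3].
exists k => //.
have a2 := h2 k k2; have a3 := h3 k.+1 (leqW k3).
have l0 := L_gt0 k.+1.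
have yl : y k <= theta - mu.
  by move: a2; rewrite ler_norml => /andP[? ?]; lra.
have := ler_wpM2r (ltW l0) yl; rewrite /y divfK ?gt_eqF // => h.
have : C <= mu * L k.+1 by rewrite mulrC -ler_pdivrMr.
lra.
Qed.

End ratios.

(** * Cubic exponents of Sturmian continued fractions *)

Theorem theorem2p1 (R : realType) (a b : nat) (s : nat -> nat)
    (ha : (0 < a)%N) (hb : (0 < b)%N) (hab : a <> b)
    (hs : forall k : nat, (0 < k)%N -> (0 < s k)%N) :
  let zeta : R := sturmian_cf R a b s in
  let sigma : R := sturmian_sigma R s in
  [/\ w_exp 3 zeta = one_plus_two_over sigma /\
      wstar_exp 3 zeta = one_plus_two_over sigma,
      lambda_exp 3 zeta = (1 / (1 + 2 * sigma))%:E,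
      w_hat 3 zeta = 3%:E,
      lambda_hat 3 zeta = (1 / 3)%:E &
      wstar_hat 3 zeta = (2 + sigma)%:E].
Proof.
move=> zeta sigma.
exact: (cubic_exponents (sturmian_approximations R ha hb hab hs)
  (sturmian_sigma01 R hs) (@sturmian_ratio_ge R a b s ha hb hs)
  (@sturmian_ratio_le R a b s ha hb hs)).
Qed.
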